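(* A connected digraph $D$ is not DP-degree-colorable if and only if every block $B$ of $D$ satisfies one of: (a) $B$ is a directed cycle of length $\ge 2$; (b) $B$ is a bidirected cycle of length $\ge 3$; (c) $B$ is a bidirected complete graph.
   Context: Digraphs are finite, without loops and parallel arcs (opposite arcs allowed); connectivity means weak connectivity (connectivity of the underlying undirected graph). A separating vertex of a connected digraph $D$ is a vertex $v$ with $D-v$ disconnected; a block is a maximal subdigraph without a separating vertex. A directed cycle of length $2$ is a digon. A bidirected graph is obtained from a simple undirected graph by replacing every edge with two opposite arcs. A cover of a digraph $D$ is a pair $(X,H)$: pairwise disjoint sets $X_v$ ($v\in V(D)$), and a digraph $H$ on $\bigcup_v X_v$ with each $X_v$ independent, such that for each arc $uv\in A(D)$ the arcs of $H$ from $X_u$ to $X_v$ form a (possibly empty) matching and every arc of $H$ arises in this way. $D$ is $(X,H)$-colorable if there is a set $T\subseteq V(H)$ with $|T\cap X_v|=1$ for all $v$ such that $H[T]$ contains no directed cycle. $D$ is DP-degree-colorable if $D$ is $(X,H)$-colorable for every cover $(X,H)$ with $|X_v|\ge\max\{d_D^+(v),d_D^-(v)\}$ for all $v\in V(D)$. *)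

(* Defs.v *)
From mathcomp Require Import all_boot.
Set Implicit Arguments.
Unset Strict Implicit.
Unset Printing Implicit Defensive.

(* The carrier U is only an ambient finite type: the vertices are the elements
   of [vset D], so that D, its subdigraphs and the digraphs D - v all live in
   [digraph U].  The empty digraph is allowed here. *)
Record digraph (U : finType) := Digraph {
  vset : {set U};
  aset : {set U * U};
  asetP : [forall a in aset, [&& a.1 \in vset, a.2 \in vset & a.1 != a.2]]
}.

Definition is_arc (U : finType) (D : digraph U) : rel U :=
  fun u v => (u, v) \in aset D.

Definition outdeg (U : finType) (D : digraph U) (v : U) : nat :=
  #|[set w | is_arc D v w]|.

Definition indeg (U : finType) (D : digraph U) (v : U) : nat :=
  #|[set w | is_arc D w v]|.

Definition subdigraph (U : finType) (C D : digraph U) : Prop :=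
  vset C \subset vset D /\ aset C \subset aset D.

Fact induced_subproof (U : finType) (D : digraph U) (S : {set U}) :
  [forall a in aset D :&: setX S S,
     [&& a.1 \in vset D :&: S, a.2 \in vset D :&: S & a.1 != a.2]].
Proof.
apply/forall_inP => -[u v] /setIP[Duv /setXP[Su Sv]] /=.
have /and3P[/= Du Dv ->] := forall_inP (asetP D) _ Duv.
by rewrite !inE Du Su Dv Sv.
Qed.

Definition induced (U : finType) (D : digraph U) (S : {set U}) : digraph U :=
  Digraph (induced_subproof D S).

Definition del_vertex (U : finType) (D : digraph U) (v : U) : digraph U :=
  induced D [set~ v].

Definition adj (U : finType) (D : digraph U) : rel U :=
  fun u v => is_arc D u v || is_arc D v u.

(* The empty digraph is neither connected nor disconnected; in particular the
   vertex of a one-vertex digraph is not separating. *)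
Definition connected (U : finType) (D : digraph U) : Prop :=
  vset D != set0 /\ {in vset D &, forall u v, connect (adj D) u v}.

Definition disconnected (U : finType) (D : digraph U) : Prop :=
  exists u v, [/\ u \in vset D, v \in vset D & ~~ connect (adj D) u v].

Definition separating (U : finType) (D : digraph U) (v : U) : Prop :=
  v \in vset D /\ disconnected (del_vertex D v).

Definition nonseparable (U : finType) (D : digraph U) : Prop :=
  connected D /\ ~ exists v, separating D v.

Definition block (U : finType) (D B : digraph U) : Prop :=
  [/\ subdigraph B D, nonseparable B &
      forall C : digraph U, subdigraph C D -> nonseparable C ->
        subdigraph B C -> subdigraph C B].

(* [next s] is the cyclic successor in the sequence s. *)
Definition dicycle (U : finType) (n : nat) (D : digraph U) : Prop :=
  exists s : seq U, [/\ uniq s, size s = n, vset D = [set x in s] &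
    aset D = [set (x, next s x) | x in s]].

Definition acyclic (U : finType) (D : digraph U) : Prop :=
  ~ exists (n : nat) (C : digraph U),
      [/\ 2 <= n, dicycle n C & subdigraph C D].

Record sgraph (U : finType) := SGraph {
  gvset : {set U};
  geset : {set {set U}};
  gesetP : [forall e in geset, (e \subset gvset) && (#|e| == 2)]
}.

Definition cycle_graph (U : finType) (n : nat) (G : sgraph U) : Prop :=
  exists s : seq U, [/\ uniq s, size s = n, gvset G = [set x in s] &
    geset G = [set [set x; next s x] | x in s]].

Definition complete_graph (U : finType) (G : sgraph U) : Prop :=
  geset G = [set e : {set U} | (e \subset gvset G) && (#|e| == 2)].

Definition bidirection (U : finType) (G : sgraph U) (D : digraph U) : Prop :=
  vset D = gvset G /\ forall u v, is_arc D u v = ([set u; v] \in geset G).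

Definition bidirected_cycle (U : finType) (n : nat) (D : digraph U) : Prop :=
  exists2 G : sgraph U, cycle_graph n G & bidirection G D.

Definition bidirected_complete (U : finType) (D : digraph U) : Prop :=
  exists2 G : sgraph U, complete_graph G & bidirection G D.

Definition arcs_from_to (W : finType) (H : digraph W) (S T : {set W}) :
  {set W * W} := [set a in aset H | (a.1 \in S) && (a.2 \in T)].

Definition matching (W : finType) (M : {set W * W}) : Prop :=
  {in M &, forall a b, a != b ->
     [disjoint [set a.1; a.2] & [set b.1; b.2]]}.

(* The values of X outside [vset D] are irrelevant. *)
Record dp_cover (U : finType) (D : digraph U) (W : finType)
    (X : U -> {set W}) (H : digraph W) : Prop := DPCover {
  cover_disjoint : {in vset D &, forall u v, u != v -> [disjoint X u & X v]};
  cover_vset : vset H = \bigcup_(v in vset D) X v;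
  cover_independent :
    {in vset D, forall v, {in X v &, forall x y, ~~ is_arc H x y}};
  cover_matching :
    forall u v, is_arc D u v -> matching (arcs_from_to H (X u) (X v));
  cover_arcs :
    forall x y, is_arc H x y ->
      exists u v, [/\ is_arc D u v, x \in X u & y \in X v]
}.

Definition colorable (U : finType) (D : digraph U) (W : finType)
    (X : U -> {set W}) (H : digraph W) : Prop :=
  exists T : {set W}, [/\ T \subset vset H,
    {in vset D, forall v, #|T :&: X v| = 1} & acyclic (induced H T)].

Definition dp_degree_colorable (U : finType) (D : digraph U) : Prop :=
  forall (W : finType) (X : U -> {set W}) (H : digraph W),
    dp_cover D X H ->
    {in vset D, forall v, maxn (outdeg D v) (indeg D v) <= #|X v|} ->
    colorable D X H.

(* Main.v *)
Require Import Defs.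
From mathcomp Require Import all_boot.
From Stdlib Require Import Classical.
Set Implicit Arguments.
Unset Strict Implicit.
Unset Printing Implicit Defensive.

(* Orienting the constraints, a vertex can be coloured so that it becomes a sink
   (or a source) of the coloured part as soon as it has more colours than
   coloured out-neighbours (or in-neighbours); hence a connected digraph can be
   coloured greedily towards any prescribed last vertex z.  If the cover is bad,
   the colours of z then meet those of its out-neighbours bijectively.  When D
   has no separating vertex this forces D to be d-regular, and forces any two
   out-neighbours (or two in-neighbours) a, b of a vertex to be joined by a digon
   unless D - a - b is disconnected: otherwise give a and b first two colours
   conflicting with the same colour of z.  For d = 1 the digraph D is a directed
   cycle.  For d >= 2, D is complete if it has no cut {u, w}; if it has one, a
   smallest side of such a cut is a single vertex whose two neighbours are u and
   w, so d = 2, and from this vertex the digons propagate around a bidirected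
   cycle.  A separating vertex v splits D into two parts; removing from X_v the
   colours with out-arcs (or in-arcs) to a colouring of one part turns a bad cover
   of D into one of the other part, and conversely the disjoint union of bad
   covers of the parts is bad. *)

(** * Acyclicity via sinks, colourings as functions *)

(** Acyclicity is used as the existence of a sink in every nonempty set. This form survives
    restriction, extension by a sink and reversal, so every argument on out-neighbours also serves
    in-neighbours through [opp]. Regularity comes from precolouring: if D - a is connected and ua is
    an arc, any colour x of a may be fixed first, and a bad cover must then send an arc from X_u to
    x. Hence X_a is at most as large as X_u, and reversal gives equality. From there on the cover is
    forgotten and only degrees and the digon rule are kept. The obstacle is that the rule is silent
    at cut pairs {a, b}. It becomes unconditional near a smallest side I of a cut {u, w}, because no
    vertex of I forms a cut pair with a vertex of I, u or w. If every vertex of I had an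
    in-neighbour and an out-neighbour in I, then u and w would be joined by digons to all of I,
    which is impossible; so some vertex of I has all its in-neighbours, or all its out-neighbours,
    among u and w. At a separating vertex v, colours are removed in the direction in which v has
    fewer neighbours in the coloured part; this choice keeps both degree bounds at v. *)

Definition sinks (T : finType) (r : rel T) (P : {set T}) : Prop :=
  forall S : {set T}, S \subset P -> S != set0 ->
    exists2 x, x \in S & {in S, forall y, ~~ r x y}.

Lemma sinks_sub (T : finType) (r : rel T) (P Q : {set T}) :
  Q \subset P -> sinks r P -> sinks r Q.
Proof. by move=> QP sP S SQ; apply: sP; apply: subset_trans QP. Qed.

Lemma sinks_eq (T : finType) (r r' : rel T) (P : {set T}) :
  {in P &, r =2 r'} -> sinks r P -> sinks r' P.
Proof.
move=> rr' sP S SP S0; have [x xS xs] := sP S SP S0; exists x => // y yS.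
by rewrite -rr' ?xs // (subsetP SP).
Qed.

(** Remove a sink x: a source of the remaining set is a source of the whole set, since x sends no
    arc into it. *)
Lemma sinks_rev (T : finType) (r : rel T) (P : {set T}) :
  sinks r P -> sinks (fun x y => r y x) P.
Proof.
move=> sP S; have [n] := ubnP #|S|; elim: n S => // n IHn S ltSn SP S0.
have [x xS xsink] := sP S SP S0.
have [S10 | S1] := eqVneq (S :\ x) set0.
  exists x => // y yS; have [-> | yx] := eqVneq y x; first exact: xsink.
  by have := in_set0 y; rewrite -S10 !inE yx yS.
have [||y] := IHn (S :\ x) _ _ S1.
- by move: ltSn; rewrite (cardsD1 x S) xS.
- exact: subset_trans (subsetDl _ _) SP.
rewrite !inE => /andP[yx yS] ysrc; exists y => // z zS.
have [-> | zx] := eqVneq z x; first exact: xsink.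
by apply: ysrc; rewrite !inE zx.
Qed.

Lemma sinkless_cycle (T : finType) (r : rel T) (S : {set T}) (x0 : T) :
  x0 \in S -> irreflexive r ->
  {in S, forall x, exists2 y, y \in S & r x y} ->
  exists s : seq T, [/\ uniq s, 2 <= size s, {subset s <= S} &
    {in s, forall x, r x (next s x)}].
Proof.
move=> x0S rirr Sr.
pose f x := odflt x [pick y in S | r x y].
have fS x : x \in S -> (f x \in S) && r x (f x).
  move=> xS; rewrite /f; case: pickP => [y /andP[-> ->] // | no].
  by have [y yS rxy] := Sr x xS; have := no y; rewrite /= yS rxy.
(* A vertex x with the smallest forward orbit lies on a cycle of f: the orbit of f x is contained in
   that of x and cannot be smaller. *)
case: (arg_minnP (fun x => order f x) x0S) => x xS xmin.
have eqord : order f (f x) = order f x.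
  apply/eqP; rewrite eqn_leq xmin ?andbT; last by case/andP: (fS x xS).
  apply: subset_leq_card; apply/subsetP => y.
  by rewrite !inE => /(connect_trans (fconnect1 f x)).
have cyc : fcycle f (orbit f x) by apply/(orbitPcycle 1 0).
have sS : {subset orbit f x <= S}.
  move=> y; rewrite -fconnect_orbit => /iter_findex <-.
  by elim: (findex f x y) => //= n /fS /andP[].
have nx y : y \in orbit f x -> next (orbit f x) y = f y.
  by move=> yo; have /eqP <- := next_cycle cyc yo.
exists (orbit f x); split=> //.
  (* An orbit of length one would make x a fixed point of f, hence a loop of r. *)
  rewrite size_orbit; have := order_gt0 f x; have := in_orbit f x.
  rewrite -(size_orbit f x); case: (orbit f x) nx => // y [] // nx.
  rewrite inE => /eqP xy; have := nx x; rewrite xy inE eqxx /= eqxx => /(_ isT) ff.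
  by have /andP[_] := fS x xS; rewrite xy -ff rirr.
by move=> y yo; rewrite nx //; have /andP[] := fS y (sS y yo).
Qed.

Lemma is_arc_in (U : finType) (D : digraph U) u v :
  is_arc D u v -> [/\ u \in vset D, v \in vset D & u != v].
Proof. by move=> uv; have /and3P[] := forall_inP (asetP D) (u, v) uv. Qed.

Lemma is_arc_induced (U : finType) (D : digraph U) (S : {set U}) u v :
  is_arc (induced D S) u v = [&& is_arc D u v, u \in S & v \in S].
Proof. by rewrite /is_arc !inE. Qed.

Lemma next_neq (T : eqType) (s : seq T) x :
  uniq s -> 2 <= size s -> x \in s -> x != next s x.
Proof.
move=> us s2 /rot_to[i s' sE]; rewrite -(next_rot i us) sE.
have : uniq (x :: s') by rewrite -sE rot_uniq.
have : size (x :: s') = size s by rewrite -sE size_rot.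
case: s' {sE} => [/= sz | y s' _ /=]; first by rewrite -sz in s2.
by rewrite eqxx inE negb_or => /andP[/andP[]].
Qed.

Lemma dicycle_subproof (T : finType) (s : seq T) : uniq s -> 2 <= size s ->
  [forall a in [set (x, next s x) | x in s],
     [&& a.1 \in [set x in s], a.2 \in [set x in s] & a.1 != a.2]].
Proof.
move=> us s2; apply/forall_inP => _ /imsetP[x xs ->] /=.
by rewrite !inE xs mem_next xs next_neq.
Qed.

Lemma acyclic_sinks (W : finType) (H : digraph W) :
  acyclic H <-> sinks (is_arc H) (vset H).
Proof.
split=> [aH S SH /set0Pn[x0 x0S] | sH [n [C [n2 [s [us ss VC AC]] [CV CA]]]]].
  apply: NNPP => nosink; apply: aH.
  have Sr : {in S, forall x, exists2 y, y \in S & is_arc H x y}.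
    move=> x xS; apply/exists_inP; apply: contra_notT nosink => no.
    by exists x => // y yS; apply: contraNN no => xy; apply/exists_inP; exists y.
  have irr : irreflexive (is_arc H).
    by move=> x; apply/negP => /is_arc_in[_ _]; rewrite eqxx.
  have [s [us s2 sS sr]] := sinkless_cycle x0S irr Sr.
  exists (size s), (Digraph (dicycle_subproof us s2)); split=> //.
    by exists s.
  split=> /=; first by apply/subsetP => x; rewrite inE => /sS /(subsetP SH).
  by apply/subsetP => _ /imsetP[x xs ->]; apply: sr.
have [|x] := sH (vset C) CV.
  by rewrite VC; case: s ss {us VC AC} n2 => [<- // | x s] *; apply/set0Pn; exists x; rewrite !inE eqxx.
rewrite VC inE => xs /(_ (next s x)); rewrite inE mem_next xs => /(_ isT)/negP.
by apply; apply: (subsetP CA); rewrite AC; apply/imsetP; exists x.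
Qed.

(** The transversal T becomes a choice function c, and acyclicity of H[T] is tested on the vertices
    of D by pulling h back along c. The set P allows partial colourings. *)
Definition coloring (U W : finType) (X : U -> {set W}) (h : rel W) (P : {set U})
    (c : U -> W) : Prop :=
  {in P, forall v, c v \in X v} /\ sinks (fun u v => h (c u) (c v)) P.

(** A cover seen through relations: the matching condition becomes two uniqueness conditions, which
    are exchanged when all arcs are reversed. *)
Record is_cover (U W : finType) (V : {set U}) (e : rel U) (X : U -> {set W})
    (h : rel W) : Prop := Cover {
  cov_disj : {in V &, forall u v, u != v -> [disjoint X u & X v]};
  cov_arc : {in V &, forall u v x y, x \in X u -> y \in X v -> h x y -> e u v};
  cov_out : {in V &, forall u v x y z,
    x \in X u -> y \in X v -> z \in X v -> h x y -> h x z -> y = z};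
  cov_in : {in V &, forall u v x y z,
    x \in X u -> y \in X v -> z \in X v -> h y x -> h z x -> y = z}
}.

Lemma dp_cover_is_cover (U W : finType) (D : digraph U) (X : U -> {set W}) H :
  dp_cover D X H -> is_cover (vset D) (is_arc D) X (is_arc H).
Proof.
move=> [dX vX iX mX aX].
have carc : {in vset D &, forall u v x y,
    x \in X u -> y \in X v -> is_arc H x y -> is_arc D u v}.
  move=> u v uD vD x y xu yv /aX[u' [v' [uv' xu' yv']]].
  have [u'D v'D _] := is_arc_in uv'.
  have E a b z : a \in vset D -> b \in vset D -> z \in X a -> z \in X b -> a = b.
    move=> aD bD za zb; apply/eqP; apply: contraTT isT => ab.
    by have /disjoint_setI0/setP/(_ z) := dX a b aD bD ab; rewrite !inE za zb.
  by rewrite (E u u' x) // (E v v' y).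
split=> // u v uD vD x y z xu yv zv h1 h2.
- apply/eqP; apply: contraTT isT => yz.
  have /mX/(_ (x, y) (x, z)) := carc u v uD vD x y xu yv h1.
  rewrite !inE /= xu yv zv !andbT xpair_eqE eqxx /= => /(_ h1 h2 yz).
  by move=> /disjoint_setI0/setP/(_ x); rewrite !inE eqxx.
- apply/eqP; apply: contraTT isT => yz.
  have /mX/(_ (y, x) (z, x)) := carc v u vD uD y x yv xu h1.
  rewrite !inE /= xu yv zv !andbT xpair_eqE eqxx andbT /= => /(_ h1 h2 yz).
  by move=> /disjoint_setI0/setP/(_ x); rewrite !inE eqxx !orbT.
Qed.

Lemma colorableP (U W : finType) (D : digraph U) (X : U -> {set W}) H :
  dp_cover D X H -> vset D != set0 ->
  colorable D X H <-> exists c, coloring X (is_arc H) (vset D) c.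
Proof.
move=> covH /set0Pn[v0 v0D]; split=> [[T [TH T1 /acyclic_sinks sT]] | [c [cX sc]]].
  have TI v : v \in vset D -> exists x, x \in T :&: X v.
    by move=> vD; apply/set0Pn; rewrite -card_gt0 T1.
  (* Nonemptiness of D yields an element of W, the default value that makes c a total function. *)
  have [w0 _] := TI v0 v0D.
  pose c v := odflt w0 [pick x in T :&: X v].
  have cT v : v \in vset D -> c v \in T :&: X v.
    move=> vD; rewrite /c; case: pickP => [x //|no].
    by have [x xT] := TI v vD; have := no x; rewrite xT.
  exists c; split=> [v /cT | S SD S0]; first by rewrite inE => /andP[].
  have ST : c @: S \subset vset (induced H T).
    apply/subsetP => _ /imsetP[u /(subsetP SD) /cT uT ->].
    by move: uT; rewrite !inE => /andP[uT _]; rewrite uT (subsetP TH).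
  have [|_ /imsetP[x xS ->] xs] := sT _ ST.
    by have /set0Pn[x xS] := S0; apply/set0Pn; exists (c x); apply: imset_f.
  exists x => // y yS; have := xs (c y) (imset_f c yS).
  rewrite is_arc_induced; apply: contraNN => ->.
  have := subsetP ST _ (imset_f c yS); have := subsetP ST _ (imset_f c xS).
  by rewrite !inE => /andP[_ ->] /andP[_ ->].
have cov := dp_cover_is_cover covH.
have TH : c @: vset D \subset vset H.
  apply/subsetP => _ /imsetP[v vD ->]; rewrite (cover_vset covH).
  by apply/bigcupP; exists v => //; apply: cX.
exists (c @: vset D); split=> // [v vD|].
  apply/eqP/cards1P; exists (c v); apply/setP => x; rewrite !inE.
  apply/andP/eqP => [[/imsetP[u uD ->] cu] | ->]; last by rewrite imset_f ?cX.
  apply/eqP; apply: contraTT isT => uv.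
  have {}uv : u != v by apply: contraNneq uv => ->.
  have /disjoint_setI0/setP/(_ (c u)) := cov_disj cov uD vD uv.
  by rewrite !inE cu cX.
apply/acyclic_sinks => S SD S0.
have SD' : S \subset c @: vset D.
  by apply/subsetP => x /(subsetP SD); rewrite inE => /andP[].
have [||v] := sc [set v in vset D | c v \in S].
- by apply/subsetP => v; rewrite inE => /andP[].
- have /set0Pn[x xS] := S0; have /imsetP[v vD xE] := subsetP SD' x xS.
  by apply/set0Pn; exists v; rewrite inE vD -xE.
rewrite inE => /andP[vD cvS] vs; exists (c v) => // y yS.
have /imsetP[u uD yE] := subsetP SD' y yS.
by rewrite is_arc_induced yE negb_and vs // inE uD -yE.
Qed.

(** * Connectedness and greedy colouring *)

Definition closed_in (U : finType) (r : rel U) (K A : {set U}) : bool :=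
  [forall x in A, forall y in K, r x y ==> (y \in A)].

(** For symmetric r this is connectivity of the graph induced on K. Since K is an argument, deleting
    vertices changes only a set. The empty set counts as connected, so small digraphs need no
    special case when vertices are deleted. *)
Definition conn (U : finType) (r : rel U) (K : {set U}) : bool :=
  [forall A : {set U}, [&& A \subset K, A != set0 & closed_in r K A] ==> (A == K)].

Lemma closed_inP (U : finType) (r : rel U) (K A : {set U}) :
  reflect (forall x y, x \in A -> y \in K -> r x y -> y \in A) (closed_in r K A).
Proof.
apply: (iffP forall_inP) => [cA x y xA yK rxy | cA x xA].
  by have /forall_inP/(_ y yK)/implyP := cA x xA; apply.
by apply/forall_inP => y yK; apply/implyP; apply: cA.
Qed.

Lemma conn_closed (U : finType) (r : rel U) (K A : {set U}) :
  conn r K -> A \subset K -> A != set0 ->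
  (forall x y, x \in A -> y \in K -> r x y -> y \in A) -> A = K.
Proof.
move=> /forallP/(_ A)/implyP cK AK A0 cA; apply/eqP/cK.
by rewrite AK A0; apply/closed_inP.
Qed.

Lemma conn_nbr (U : finType) (r : rel U) (K : {set U}) x y :
  conn r K -> x \in K -> y \in K -> x != y -> exists2 z, z \in K & r x z.
Proof.
move=> cK xK yK xy; apply/exists_inP; apply: contraT => /exists_inPn none.
have E : [set x] = K.
  apply: (conn_closed cK); rewrite ?sub1set //.
    by apply/set0Pn; exists x; rewrite inE.
  by move=> _ z /set1P -> zK; rewrite (negPf (none z zK)).
by move: yK; rewrite -E inE eq_sym (negPf xy).
Qed.

Definition separation (U : finType) (r : rel U) (K A B : {set U}) : Prop :=
  [/\ A != set0, B != set0, A :&: B = set0, A :|: B = K &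
    forall x y, x \in A -> y \in B -> ~~ r x y].

Lemma separationC (U : finType) (r : rel U) (K A B : {set U}) :
  symmetric r -> separation r K A B -> separation r K B A.
Proof.
move=> sr [A0 B0 AB ABK rAB]; split=> //; first by rewrite setIC.
  by rewrite setUC.
by move=> x y xB yA; rewrite sr rAB.
Qed.

Lemma connPn (U : finType) (r : rel U) (K : {set U}) :
  ~~ conn r K -> exists A B, separation r K A B.
Proof.
rewrite negb_forall => /existsP[A]; rewrite negb_imply.
move=> /andP[/and3P[AK A0 /closed_inP cA] neA].
exists A, (K :\: A); split=> //.
- by rewrite setD_eq0; apply: contraNN neA => KA; rewrite eqEsubset AK.
- by apply/setP => x; rewrite !inE; case: (x \in A).
- by apply/setP => x; rewrite !inE; case: (boolP (x \in A)) => // /(subsetP AK) ->.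
- by move=> x y xA /setDP[yK]; apply: contraNN; apply: cA.
Qed.

Lemma conn_separation (U : finType) (r : rel U) (K A B : {set U}) :
  conn r K -> separation r K A B -> False.
Proof.
move=> cK [A0 /set0Pn[x xB] AB ABK rAB].
have AK : A = K.
  apply: conn_closed cK _ A0 _; first by rewrite -ABK subsetUl.
  move=> y z yA; rewrite -ABK inE => /orP[//|zB] ryz.
  by have := rAB y z yA zB; rewrite ryz.
by have := in_set0 x; rewrite -AB !inE xB AK -ABK inE xB orbT.
Qed.

(** The function phi plays the role of the distance to z: when vertices are coloured by decreasing
    phi, each one except z still has an uncoloured neighbour. It is built by growing a set from {z}
    one neighbour at a time. *)
Lemma conn_rank (U : finType) (r : rel U) (K : {set U}) z :
  symmetric r -> conn r K -> z \in K ->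
  exists phi : U -> nat, {in K, forall w, w != z ->
    exists w', [/\ w' \in K, phi w' < phi w & r w w']}.
Proof.
move=> sr cK zK.
pose good (A : {set U}) (phi : U -> nat) := {in A, forall w, w != z ->
    exists w', [/\ w' \in A, phi w' < phi w & r w w']}.
suff H n A phi : #|K :\: A| <= n -> A \subset K -> z \in A -> good A phi ->
    exists phi, good K phi.
  apply: (H #|K| [set z] (fun=> 0)); rewrite ?sub1set ?inE //.
    by apply: subset_leq_card; apply: subsetDl.
  by move=> w; rewrite inE => ->.
elim: n A phi => [|n IHn] A phi.
  rewrite leqn0 cards_eq0 setD_eq0 => KA AK zA gA; exists phi.
  by have <- : A = K by apply/eqP; rewrite eqEsubset AK.
move=> cKA AK zA gA; have [<- | neA] := eqVneq A K; first by exists phi.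
have : ~~ closed_in r K A.
  apply: contraNN neA => /closed_inP cA; apply/eqP.
  by apply: conn_closed cK AK _ cA; apply/set0Pn; exists z.
rewrite negb_forall_in => /exists_inP[x xA]; rewrite negb_forall_in.
move=> /exists_inP[y yK]; rewrite negb_imply => /andP[rxy yA].
have yz : y != z by apply: contraNneq yA => ->.
pose psi u := if u == y then (phi x).+1 else phi u.
have psiA u : u \in A -> psi u = phi u.
  by move=> uA; rewrite /psi; case: eqP uA => // ->; rewrite (negPf yA).
apply: (IHn (y |: A) psi).
- have : K :\: (y |: A) \proper K :\: A.
    apply/properP; split; first by apply: setDS; apply: subsetUr.
    by exists y; rewrite !inE ?eqxx ?yA ?yK.
  by move/proper_card/leq_trans/(_ cKA).
- by rewrite subUset sub1set yK.
- by rewrite inE zA orbT.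
- move=> w; rewrite !inE => /orP[/eqP -> _ | wA wz].
    exists x; rewrite (psiA x xA) /psi eqxx ltnS leqnn sr rxy !inE xA orbT.
    by [].
  have [w' [w'A lt rw]] := gA w wA wz.
  by exists w'; rewrite !psiA // !inE w'A orbT.
Qed.

Definition outn (U : finType) (e : rel U) v := [set w | e v w].
Definition nbr (U : finType) (e : rel U) : rel U := fun u v => e u v || e v u.
Definition opp (T : finType) (r : rel T) : rel T := fun x y => r y x.

Lemma nbr_sym (U : finType) (e : rel U) : symmetric (nbr e).
Proof. by move=> u v; rewrite /nbr orbC. Qed.

(** Reversing a directed cycle gives a directed cycle. This is what turns each statement about
    out-neighbours into one about in-neighbours. *)
Lemma coloring_opp (U W : finType) (X : U -> {set W}) (h : rel W) P c :
  coloring X (opp h) P c <-> coloring X h P c.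
Proof. by split=> -[cX sc]; split=> //; exact: sinks_rev sc. Qed.

Lemma cover_opp (U W : finType) (V : {set U}) e (X : U -> {set W}) h :
  is_cover V e X h -> is_cover V (opp e) X (opp h).
Proof.
move=> [d a o i]; split=> // u v uV vV x y xu yv; exact: a.
Qed.

(** * Extending a partial colouring *)

Section Extension.
Variables (U W : finType) (X : U -> {set W}) (h : rel W).

Lemma coloring_out (P : {set U}) c v x :
  coloring X h P c -> v \notin P -> x \in X v -> ~~ h x x ->
  {in P, forall u, ~~ h x (c u)} ->
  exists c', [/\ coloring X h (v |: P) c', {in P, c' =1 c} & c' v = x].
Proof.
move=> [cX sc] vP xv hxx xout; pose c' u := if u == v then x else c u.
have cP : {in P, c' =1 c}.
  by move=> u uP; rewrite /c'; case: eqP uP => // ->; rewrite (negPf vP).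
have cv : c' v = x by rewrite /c' eqxx.
exists c'; split=> //; split=> [u | S SP S0].
  by rewrite !inE => /orP[/eqP -> | uP]; rewrite ?cv ?cP // cX.
have [vS | vS] := boolP (v \in S).
  exists v => // u /(subsetP SP); rewrite cv !inE.
  by case/orP => [/eqP -> | uP]; rewrite ?cv // cP // xout.
have SP' : S \subset P.
  apply/subsetP => u uS; have := subsetP SP u uS; rewrite !inE.
  by case: eqP uS => // ->; rewrite (negPf vS).
have [u uS us] := sc S SP' S0; exists u => // w wS.
by rewrite !cP ?us // (subsetP SP').
Qed.

End Extension.

Section Cover.
Variables (U W : finType) (V : {set U}).
Implicit Types (e : rel U) (X : U -> {set W}) (h : rel W).

Lemma cover_irr e X h v x : irreflexive e -> is_cover V e X h ->
  v \in V -> x \in X v -> ~~ h x x.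
Proof.
by move=> ie cov vV xv; apply/negP => /(cov_arc cov vV vV xv xv); rewrite ie.
Qed.

(* The new vertex becomes a sink, so no directed cycle passes through it. *)
Lemma extend_out e X h (P : {set U}) c v :
  irreflexive e -> is_cover V e X h -> P \subset V -> v \in V -> v \notin P ->
  coloring X h P c -> #|outn e v :&: P| < #|X v| ->
  exists2 c', coloring X h (v |: P) c' & {in P, c' =1 c}.
Proof.
move=> ie cov PV vV vP cc lt.
have [/exists_inP[x xv /forall_inP xout] | no] :=
    boolP [exists x in X v, [forall u in P, ~~ h x (c u)]].
  have [c' [cc' c'P _]] := coloring_out cc vP xv (cover_irr ie cov vV xv) xout.
  by exists c'.
(* If every colour x of v is blocked, g sends x to a coloured out-neighbour that blocks it. The
   matching condition makes g injective, so v has too many coloured out-neighbours. *)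
pose g x := odflt v [pick u in P | h x (c u)].
have gP x : x \in X v -> (g x \in P) && h x (c (g x)).
  move=> xv; rewrite /g; case: pickP => [u /andP[-> ->] // | nou].
  case/exists_inP: no; exists x => //; apply/forall_inP => u uP.
  by have := nou u; rewrite /= uP => /negbT.
have ginj : {in X v &, injective g}.
  move=> x y xv yv gxy; have /andP[gx hx] := gP x xv; have /andP[_ hy] := gP y yv.
  have gV := subsetP PV _ gx.
  by apply: (cov_in cov gV vV (cc.1 _ gx) xv yv hx); rewrite gxy.
have : g @: X v \subset outn e v :&: P.
  apply/subsetP => _ /imsetP[x xv ->]; have /andP[gx hx] := gP x xv.
  by rewrite !inE gx (cov_arc cov vV (subsetP PV _ gx) xv (cc.1 _ gx) hx).
by move/subset_leq_card; rewrite card_in_imset // leqNgt lt.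
Qed.

Lemma extend_in e X h (P : {set U}) c v :
  irreflexive e -> is_cover V e X h -> P \subset V -> v \in V -> v \notin P ->
  coloring X h P c -> #|outn (opp e) v :&: P| < #|X v| ->
  exists2 c', coloring X h (v |: P) c' & {in P, c' =1 c}.
Proof.
move=> ie cov PV vV vP cc lt.
have ie' : irreflexive (opp e) by move=> x; apply: ie.
have [c' cc' c'P] := extend_out ie' (cover_opp cov) PV vV vP
  (proj2 (coloring_opp X h P c) cc) lt.
by exists c' => //; apply/coloring_opp.
Qed.

(** The vertices of K other than z are coloured by decreasing rank towards z, after an arbitrary
    colouring of P. Leaving P free allows one or two vertices to be precoloured later. *)
Lemma greedy e X h (K P : {set U}) z c :
  irreflexive e -> is_cover V e X h ->
  {in K, forall v, maxn #|outn e v| #|outn (opp e) v| <= #|X v|} ->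
  P \subset V -> K \subset V -> [disjoint P & K] -> z \in K -> conn (nbr e) K ->
  coloring X h P c ->
  exists2 c', coloring X h (P :|: (K :\ z)) c' & {in P, c' =1 c}.
Proof.
move=> ie cov deg PV KV dPK zK cK cc.
have [phi] := conn_rank (nbr_sym e) cK zK.
(* Connectivity of K is traded for the rank function, which plainly remains valid when a vertex of
   largest rank is removed. *)
have [n] := ubnP #|K|; elim: n => // n IHn in K P c deg PV KV dPK zK {cK} cc *.
move=> ltKn rk.
have [Kz | /set0Pn[w0 w0K]] := eqVneq (K :\ z) set0.
  by exists c => //; rewrite Kz setU0.
case: (arg_maxnP phi w0K) => w wKz wmax; have /setD1P[wz wK] : w \in K :\ z := wKz.
have [w' [w'K lt ww']] := rk w wK wz.
have wV := subsetP KV w wK.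
have KP u : u \in K -> u \notin P.
  by move=> uK; apply/negP => uP; have /disjoint_setI0/setP/(_ u) := dPK; rewrite !inE uP uK.
have wP := KP w wK; have w'P := KP w' w'K.
have degw := deg w wK; rewrite geq_max in degw; have /andP[dout din] := degw.
have [c1 cc1 c1P] : exists2 c', coloring X h (w |: P) c' & {in P, c' =1 c}.
  (* The neighbour w' is still uncoloured, so w misses at least one coloured neighbour in the
     direction of its arc with w'. *)
  have ltd (N : {set U}) : w' \in N -> #|N :&: P| < #|N|.
    move=> w'N; apply: proper_card; apply/properP; split; first exact: subsetIl.
    by exists w' => //; rewrite inE (negPf w'P) andbF.
  case/orP: ww' => ww'.
    by apply: (extend_out ie cov) => //; apply: leq_trans dout; apply: ltd; rewrite inE.
  by apply: (extend_in ie cov) => //; apply: leq_trans din; apply: ltd; rewrite inE.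
have [|||||||c2 cc2 c2P] := IHn (K :\ w) (w |: P) c1 _ _ _ _ _ cc1.
- by move=> v; rewrite inE => /andP[_]; apply: deg.
- by rewrite subUset sub1set wV.
- exact: subset_trans (subsetDl _ _) KV.
- rewrite -setI_eq0; apply/eqP/setP => u; rewrite !inE.
  by case: eqP => //= _; case uP: (u \in P) => //=; apply/negP => /KP; rewrite uP.
- by rewrite !inE zK eq_sym wz.
- by move: ltKn; rewrite (cardsD1 w K) wK.
- move=> u; rewrite !inE => /andP[uw uK] uz.
  have [u' [u'K ltu uu']] := rk u uK uz.
  exists u'; split=> //; rewrite !inE u'K andbT; apply: contraTneq ltu => ->.
  by rewrite -leqNgt; apply: (wmax u); apply/setD1P.
exists c2; last by move=> u uP; rewrite c2P ?c1P // !inE uP orbT.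
have <- // : w |: P :|: K :\ w :\ z = P :|: K :\ z.
apply/setP => u; rewrite !inE; case: (eqVneq u w) => [-> | _] //=.
by rewrite wz wK orbT.
Qed.

End Cover.

(** * Bad covers of connected digraphs *)

Lemma eq_conn (U : finType) (r r' : rel U) (K : {set U}) :
  {in K &, r =2 r'} -> conn r K = conn r' K.
Proof.
move=> rr'; apply: eq_forallb => A; case AK: (A \subset K) => //=.
case: (A != set0) => //=; congr (_ ==> _).
apply: eq_forallb_in => x xA; apply: eq_forallb_in => y yK.
by rewrite rr' // (subsetP AK).
Qed.

Lemma nbr_opp (U : finType) (e : rel U) (K : {set U}) :
  conn (nbr (opp e)) K = conn (nbr e) K.
Proof. by apply: eq_conn => x y _ _; rewrite /nbr /opp orbC. Qed.

Definition uncolorable (U W : finType) (V : {set U}) (X : U -> {set W}) h : Prop :=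
  ~ exists c, coloring X h V c.

Lemma uncolorable_opp (U W : finType) (V : {set U}) (X : U -> {set W}) h :
  uncolorable V X h -> uncolorable V X (opp h).
Proof. by move=> bad [c /coloring_opp cc]; apply: bad; exists c. Qed.

Definition is_digraph (U : finType) (V : {set U}) (e : rel U) : Prop :=
  forall u v, e u v -> [/\ u \in V, v \in V & u != v].

Lemma is_digraph_opp (U : finType) (V : {set U}) (e : rel U) :
  is_digraph V e -> is_digraph V (opp e).
Proof. by move=> eV u v /eV[vV uV vu]; rewrite eq_sym. Qed.

Record bad_cover (U W : finType) (V : {set U}) (e : rel U) (X : U -> {set W})
    (h : rel W) : Prop := BadCover {
  bad_digraph : is_digraph V e;
  bad_is_cover : is_cover V e X h;
  bad_deg : {in V, forall v, maxn #|outn e v| #|outn (opp e) v| <= #|X v|};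
  bad_uncolorable : uncolorable V X h
}.

Lemma bad_cover_opp (U W : finType) (V : {set U}) (e : rel U) (X : U -> {set W}) h :
  bad_cover V e X h -> bad_cover V (opp e) X (opp h).
Proof.
move=> [eV cov deg bad]; split.
- exact: is_digraph_opp.
- exact: cover_opp.
- by move=> v vV; rewrite maxnC; apply: deg.
- exact: uncolorable_opp.
Qed.

Section BadCover.
Variables (U W : finType) (V : {set U}) (X : U -> {set W}).
Implicit Types (e : rel U) (h : rel W).

Lemma is_digraph_irr e : is_digraph V e -> irreflexive e.
Proof. by move=> eV x; apply/negP => /eV[_ _]; rewrite eqxx. Qed.

Lemma coloring0 h c : coloring X h set0 c.
Proof. by split=> [v | S]; rewrite ?inE // subset0 => ->. Qed.

Lemma coloring1 e h v x : irreflexive e -> is_cover V e X h ->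
  v \in V -> x \in X v -> coloring X h [set v] (fun=> x).
Proof.
move=> ie cov vV xv; split=> [u /set1P -> // | S Sv /set0Pn[u uS]].
by exists u => // w _; apply: cover_irr ie cov vV xv.
Qed.

(** Colour everything except v greedily. If X_v exceeded one of the two degrees, v could be added as
    a sink or as a source. The element w0 only starts the colouring of the empty set. *)
Lemma bad_degree e h (w0 : W) : bad_cover V e X h -> conn (nbr e) V ->
  {in V, forall v, #|X v| = #|outn e v| /\ #|X v| = #|outn (opp e) v|}.
Proof.
move=> [eV cov deg bad] cV v vV.
have ie := is_digraph_irr eV.
have dis : [disjoint (set0 : {set U}) & V] by rewrite -setI_eq0 set0I.
have [c cc _] := greedy ie cov deg (sub0set V) (subxx V) dis vV cV (coloring0 h (fun=> w0)).
have [PV vP] : set0 :|: V :\ v \subset V /\ v \notin set0 :|: V :\ v.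
  by rewrite set0U subsetDl !inE eqxx.
have VE : v |: (set0 :|: V :\ v) = V by rewrite set0U setD1K.
have := deg v vV; rewrite geq_max => /andP[dout din].
split; apply/eqP; rewrite eqn_leq ?dout ?din andbT leqNgt; apply/negP => lt; apply: bad.
  have [|c' cc' _] := extend_out ie cov PV vV vP cc.
    by apply: leq_ltn_trans lt; apply: subset_leq_card; apply: subsetIl.
  by exists c'; rewrite -VE.
have [|c' cc' _] := extend_in ie cov PV vV vP cc.
  by apply: leq_ltn_trans lt; apply: subset_leq_card; apply: subsetIl.
by exists c'; rewrite -VE.
Qed.

(** Each colour of v must hit a coloured out-neighbour, or v could become a sink. The choice g of
    such a neighbour is injective by the matching condition, and counting makes it a bijection onto
    the out-neighbours. *)
Lemma bad_out_bij e h v c : bad_cover V e X h -> v \in V ->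
  #|outn e v| <= #|X v| -> coloring X h (V :\ v) c ->
  (forall w, e v w -> exists2 x, x \in X v & h x (c w)) /\
  (forall x w w', x \in X v -> e v w -> e v w' -> h x (c w) -> h x (c w') -> w = w').
Proof.
move=> [eV cov deg bad] vV dv cc; have ie := is_digraph_irr eV.
pose g x := odflt v [pick u in V :\ v | h x (c u)].
have gP x : x \in X v -> (g x \in V :\ v) && h x (c (g x)).
  move=> xv; rewrite /g; case: pickP => [u /andP[-> ->] // | nou].
  case: bad; have vn : v \notin V :\ v by rewrite !inE eqxx.
  have [|c' [cc' _ _]] := coloring_out cc vn xv (cover_irr ie cov vV xv).
    by move=> u uP; have := nou u; rewrite /= uP => /negbT.
  by exists c'; rewrite -(setD1K vV).
have VD u : u \in V :\ v -> u \in V by case/setD1P.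
have ginj x y u : x \in X v -> y \in X v -> u \in V :\ v ->
    h x (c u) -> h y (c u) -> x = y.
  by move=> xv yv uV; apply: (cov_in cov (VD _ uV) vV (cc.1 _ uV)).
have gN : g @: X v = outn e v.
  apply/eqP; rewrite eqEcard card_in_imset ?dv ?andbT.
    apply/subsetP => _ /imsetP[x xv ->]; have /andP[gx hx] := gP x xv.
    by rewrite inE (cov_arc cov vV (VD _ gx) xv (cc.1 _ gx) hx).
  move=> x y xv yv gxy; have /andP[gx hx] := gP x xv; have /andP[_ hy] := gP y yv.
  by apply: (ginj x y (g x)) => //; rewrite gxy.
have hit w : e v w -> exists x, [/\ x \in X v, w = g x & h x (c w)].
  move=> vw; have : w \in outn e v by rewrite inE.
  rewrite -gN => /imsetP[x xv ->]; exists x.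
  by have /andP[_ ->] := gP x xv.
have NV w : e v w -> w \in V :\ v.
  by move=> /eV[_ wV vw]; rewrite !inE eq_sym vw.
split=> [w /hit[x [xv _ hx]] | x w w' xv vw vw' hx hx']; first by exists x.
have [x1 [x1v wE h1]] := hit w vw; have [x2 [x2v wE' h2]] := hit w' vw'.
have x1x : x1 = x := ginj x1 x w x1v xv (NV w vw) h1 hx.
have x2x : x2 = x := ginj x2 x w' x2v xv (NV w' vw') h2 hx'.
by rewrite wE wE' x1x x2x.
Qed.

(** Give a the colour x first and colour the rest greedily towards u. By [bad_out_bij], some colour
    of u must then hit x. *)
Lemma bad_in_nbr e h u a x : bad_cover V e X h -> #|outn e u| <= #|X u| ->
  conn (nbr e) (V :\ a) -> e u a -> x \in X a -> exists2 y, y \in X u & h y x.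
Proof.
move=> badc du ca ua xa; have [eV cov deg bad] := badc.
have ie := is_digraph_irr eV; have [uV aV neua] := eV u a ua.
have [||||c cc c_a] := greedy ie cov _ _ (subsetDl V [set a]) _ _ ca (coloring1 ie cov aV xa) (z := u).
- by move=> v /setD1P[_ /deg].
- by rewrite sub1set.
- by rewrite disjoints1 !inE eqxx.
- by rewrite !inE neua.
have VE : [set a] :|: V :\ a :\ u = V :\ u.
  apply/setP => w; rewrite !inE; case: (eqVneq w a) => [-> | _] //=.
  by rewrite eq_sym neua aV.
rewrite VE in cc; have [hit _] := bad_out_bij badc uV du cc.
by have := hit a ua; rewrite c_a // inE.
Qed.

(** Choosing for each colour of a an in-neighbour in X_u is injective, since a colour of u hits at
    most one colour of a. With the reversed version this makes list sizes equal along arcs. *)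
Lemma bad_card_le e h u a : bad_cover V e X h -> #|outn e u| <= #|X u| ->
  conn (nbr e) (V :\ a) -> e u a -> #|X a| <= #|X u|.
Proof.
move=> badc du ca ua; have [eV cov deg bad] := badc; have [uV aV _] := eV u a ua.
have [/pred0P X0 | /pred0Pn[y0 _]] := boolP (pred0b (mem (X u))).
  have [->|/set0Pn[x xa]] := eqVneq (X a) set0; first by rewrite cards0.
  have [y yu _] := bad_in_nbr badc du ca ua xa.
  by have := X0 y; rewrite /= yu.
pose g x := odflt y0 [pick y in X u | h y x].
have gP x : x \in X a -> (g x \in X u) && h (g x) x.
  move=> xa; rewrite /g; case: pickP => [y // | no].
  have [y yu hy] := bad_in_nbr badc du ca ua xa.
  by have := no y; rewrite /= yu hy.
rewrite -(card_in_imset (f := g)); last first.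
  move=> x y xa ya gxy; have /andP[gx hx] := gP x xa; have /andP[_ hy] := gP y ya.
  by rewrite -gxy in hy; apply: (cov_out cov uV aV gx xa ya hx hy).
apply: subset_leq_card; apply/subsetP => _ /imsetP[x xa ->].
by have /andP[] := gP x xa.
Qed.

(** One of the two possible arcs between xa and xb is missing, so one of the vertices can be added
    as a sink to the other. *)
Lemma coloring2 e h a b xa xb : irreflexive e -> is_cover V e X h ->
  a \in V -> b \in V -> a != b -> xa \in X a -> xb \in X b ->
  ~~ (h xa xb && h xb xa) ->
  exists2 c, coloring X h [set a; b] c & c a = xa /\ c b = xb.
Proof.
move=> ie cov; wlog hab : a b xa xb / ~~ h xb xa => [IH | ] aV bV ab xaX xbX hh.
  have [hba | hba] := boolP (h xb xa); last by apply: IH.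
  have hab : ~~ h xa xb by apply: contraNN hh => ->.
  have [||c cc [cb ca]] := IH b a xb xa hab bV aV _ xbX xaX.
  - by rewrite eq_sym.
  - by rewrite andbC.
  - by exists c; rewrite 1?setUC.
have [||c [cc ca cb]] := coloring_out (coloring1 ie cov aV xaX) _ xbX (cover_irr ie cov bV xbX) (v := b).
- by rewrite inE eq_sym.
- by move=> u _.
- by exists c; [rewrite setUC | rewrite ca ?inE].
Qed.

Lemma bad_rule e h z a b : bad_cover V e X h ->
  {in V, forall v, conn (nbr e) (V :\ v)} -> {in V, forall v,
    #|X v| = #|outn e v| /\ #|X v| = #|outn (opp e) v|} ->
  e z a -> e z b -> a != b -> conn (nbr e) (V :\: [set a; b]) -> e a b && e b a.
Proof.
move=> badc c2 Xd za zb ab cab; have [eV cov deg bad] := badc.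
have ie := is_digraph_irr eV.
have [zV aV neza] := eV z a za; have [_ bV nezb] := eV z b zb.
have /card_gt0P[y yz] : 0 < #|X z|.
  by rewrite (Xd z zV).1; apply/card_gt0P; exists a; rewrite inE.
(* This is [bad_in_nbr] for the reversed cover: a fixed colour y of z conflicts with some colour of
   each out-neighbour. *)
have nb w : e z w -> exists2 x, x \in X w & h y x.
  move=> zw; have [_ wV _] := eV z w zw.
  have [||x xw hx] := bad_in_nbr (bad_cover_opp badc) _ _ (zw : opp e w z) yz.
  - by rewrite -(Xd w wV).2.
  - by rewrite nbr_opp c2.
  - by exists x.
have [xa xaX ha] := nb a za; have [xb xbX hb] := nb b zb.
have [hh | hh] := boolP (h xa xb && h xb xa).
  have /andP[h1 h2] := hh.
  by rewrite (cov_arc cov aV bV xaX xbX h1) (cov_arc cov bV aV xbX xaX h2).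
have [c0 cc0 [c0a c0b]] := coloring2 ie cov aV bV ab xaX xbX hh.
have [||||c cc cE] := greedy ie cov _ _ (subsetDl V [set a; b]) _ _ cab cc0 (z := z).
- by move=> v /setDP[/deg].
- by rewrite subUset !sub1set aV.
- by rewrite -setI_eq0; apply/eqP/setP => w; rewrite !inE andbA andbN.
- by rewrite !inE negb_or neza nezb.
have VE : [set a; b] :|: (V :\: [set a; b]) :\ z = V :\ z.
  apply/setP => w; rewrite !inE negb_or.
  case: (eqVneq w a) => [-> | _] /=; first by rewrite eq_sym neza aV.
  by case: (eqVneq w b) => [-> | _] //=; rewrite eq_sym nezb bV.
rewrite VE in cc.
have dz : #|outn e z| <= #|X z| by rewrite -(Xd z zV).1.
have [_ uni] := bad_out_bij badc zV dz cc.
(* The colour y hits the colours of both a and b, against the uniqueness in [bad_out_bij]. *)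
case/eqP: ab; apply: (uni y) => //; rewrite cE ?inE ?eqxx ?orbT //.
  by rewrite c0a.
by rewrite c0b.
Qed.

End BadCover.

(** * The structure of a regular digraph without a cut vertex *)

Definition nbr_rule (U : finType) (V : {set U}) (e : rel U) : Prop :=
  forall z a b, e z a -> e z b -> a != b -> conn (nbr e) (V :\: [set a; b]) ->
    e a b && e b a.

(** All that the structure theorem needs from a bad cover. The rule is recorded in both directions
    so that the record is stable under reversal. *)
Record regular_rule (U : finType) (V : {set U}) (e : rel U) (d : nat) : Prop :=
  RegularRule {
    rr_digraph : is_digraph V e;
    rr_conn : {in V, forall v, conn (nbr e) (V :\ v)};
    rr_out : {in V, forall v, #|outn e v| = d};
    rr_in : {in V, forall v, #|outn (opp e) v| = d};
    rr_rule : nbr_rule V e;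
    rr_rule_opp : nbr_rule V (opp e)
  }.

Lemma regular_rule_opp (U : finType) (V : {set U}) (e : rel U) d :
  regular_rule V e d -> regular_rule V (opp e) d.
Proof.
move=> [eV c2 dout din R R']; split=> //; first exact: is_digraph_opp.
by move=> v vV; rewrite nbr_opp c2.
Qed.

Lemma set2_of_card2 (T : finType) (N : {set T}) x : #|N| = 2 -> x \in N ->
  exists2 y, y != x & N = [set x; y].
Proof.
move=> N2 xN; have /eqP/cards1P[y yE] : #|N :\ x| = 1.
  by move: N2; rewrite (cardsD1 x) xN => -[].
have := set11 y; rewrite -yE !inE => /andP[yx yN]; exists y => //.
by rewrite -(setD1K xN) yE.
Qed.

Section Structure.
Variables (U : finType) (V : {set U}) (d : nat).
Implicit Types (e : rel U).

Lemma rr_rule2 e z a b : regular_rule V e d ->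
  e z a && e z b || e a z && e b z -> a != b ->
  conn (nbr e) (V :\: [set a; b]) -> e a b /\ e b a.
Proof.
move=> [eV c2 dout din R R'] /orP[/andP[za zb]|/andP[az bz]] ab cab.
  by have /andP[] := R z a b za zb ab cab.
by have := R' z a b az bz ab; rewrite nbr_opp => /(_ cab)/andP[].
Qed.

(** A set whose only outside neighbour is t makes t a separating vertex as soon as some z lies
    beyond. Most contradictions below are reduced to this one. *)
Lemma no_cutvertex e (A : {set U}) t z :
  {in V, forall v, conn (nbr e) (V :\ v)} ->
  A \subset V -> A != set0 -> t \in V -> t \notin A -> z \in V -> z \notin A -> z != t ->
  (forall x y, x \in A -> y \in V -> nbr e x y -> y \in A \/ y = t) -> False.
Proof.
move=> c2 AV A0 tV tA zV zA zt cA.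
have AE : A = V :\ t.
  apply: conn_closed (c2 t tV) _ A0 _.
    by apply/subsetP => x xA; rewrite !inE (subsetP AV) // andbT; apply: contraNneq tA => <-.
  move=> x y xA; rewrite !inE => /andP[yt yV] xy.
  by case: (cA x y xA yV xy) => // yE; rewrite yE eqxx in yt.
by case/negP: zA; rewrite AE !inE zt.
Qed.

Lemma nbr_in e x y : is_digraph V e -> nbr e x y -> x \in V /\ y \in V.
Proof. by move=> eV /orP[] /eV[]. Qed.

Lemma separation_mem e (K A B : {set U}) x :
  separation (nbr e) K A B -> (x \in K) = (x \in A) || (x \in B).
Proof. by move=> [_ _ _ <- _]; rewrite inE. Qed.

Lemma separation_disj e (K A B : {set U}) x :
  separation (nbr e) K A B -> x \in A -> x \in B -> False.
Proof.
by move=> [_ _ AB _ _] xA xB; have := in_set0 x; rewrite -AB inE xA xB.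
Qed.

Lemma complete_of_3conn e : regular_rule V e d -> conn (nbr e) V -> 2 <= d ->
  (forall a b, a \in V -> b \in V -> a != b -> conn (nbr e) (V :\: [set a; b])) ->
  {in V &, forall u v, u != v -> e u v}.
Proof.
move=> rr cV d2 c3; have [eV c2 dout din R R'] := rr.
have rule z a b : e z a && e z b || e a z && e b z -> a != b -> e a b /\ e b a.
  move=> h ab; apply: (rr_rule2 rr h ab); apply: c3 => //;
    by case/orP: h => /andP[/eV[aV aV' _] /eV[bV bV' _]].
(* As d is at least 2, u has another out-neighbour a. Then a and b form a digon, so u and b are both
   in-neighbours of a and form a digon too. *)
have esym u b : e u b -> e b u.
  move=> ub; have [uV bV neub] := eV u b ub.
  have /card_gt0P[a] : 0 < #|outn e u :\ b|.
    by move: d2; rewrite -(dout u uV) (cardsD1 b) inE ub.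
  rewrite !inE => /andP[ab ua].
  have [eab eba] : e a b /\ e b a by apply: (rule u) ab; rewrite ua ub.
  have [] // : e u b /\ e b u.
  by apply: (rule a) => //; rewrite eba ua orbT.
move=> u v uV vV uv.
(* The closed neighbourhood of u is closed under adjacency: u and any neighbour y of an
   out-neighbour x of u are common in-neighbours of x. *)
have : u |: outn e u = V.
  apply: (conn_closed cV); first 2 last.
  - move=> x y; rewrite !inE => /orP[/eqP -> | ux] yV.
      by case/orP=> [-> | /esym ->]; rewrite orbT.
    move=> xy; have [-> // | yu] := eqVneq y u; rewrite /=.
    have yx : e y x by case/orP: xy => // /esym.
    by have [] : e u y /\ e y u by apply: (rule x); rewrite 1?eq_sym // ux yx orbT.
  - apply/subsetP => x; rewrite !inE => /orP[/eqP -> // | ux].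
    by have [] := eV _ _ ux.
  - by apply/set0Pn; exists u; rewrite !inE eqxx.
by move/setP/(_ v); rewrite vV !inE eq_sym (negPf uv).
Qed.

(** * Cut pairs with a side of minimum size *)

Section MinimalCut.
Variables (u w : U) (I J : {set U}).

(** I is minimal among the sides of all cut pairs, not only of {u, w}. The relation e is the only
    varying argument because the same cut also serves [opp e]. *)
Record minimal_cut e : Prop := MinimalCut {
  mc_rr : regular_rule V e d;
  mc_u : u \in V;
  mc_w : w \in V;
  mc_uw : u != w;
  mc_sep : separation (nbr e) (V :\: [set u; w]) I J;
  mc_min : forall j k A B, j \in V -> k \in V -> j != k ->
    separation (nbr e) (V :\: [set j; k]) A B -> #|I| <= #|A|
}.

Variant region_spec y : bool -> bool -> Prop :=
  | RegionUW : (y = u \/ y = w) -> region_spec y false false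
  | RegionI : y \in I -> y != u -> y != w -> region_spec y true false
  | RegionJ : y \in J -> y != u -> y != w -> region_spec y false true.

Lemma regionP e y : minimal_cut e -> y \in V -> region_spec y (y \in I) (y \in J).
Proof.
move=> [_ _ _ _ sep _] yV; have := separation_mem y sep; have := @separation_disj e _ _ _ y sep.
rewrite !inE yV andbT; case yI: (y \in I); case yJ: (y \in J) => //= dis.
- by case: dis.
- by move/norP=> []; constructor.
- by move/norP=> []; constructor.
- by move=> /negbFE/orP[] /eqP ->; constructor; [left | right].
Qed.

Lemma mc_IJ e x y : minimal_cut e -> x \in I -> y \in J -> ~~ nbr e x y && ~~ nbr e y x.
Proof.
by move=> [_ _ _ _ [_ _ _ _ nIJ] _] xI yJ; rewrite (nbr_sym e y) !nIJ.
Qed.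

Lemma mc_IV e x : minimal_cut e -> x \in I -> x \in V /\ x \notin J.
Proof.
move=> [_ _ _ _ sep _] xI; have := separation_mem x sep; rewrite xI !inE => /andP[_ ->].
by split=> //; apply/negP => xJ; apply: (separation_disj sep xI xJ).
Qed.

Lemma mc_JV e x : minimal_cut e -> x \in J -> x \in V.
Proof.
by move=> [_ _ _ _ sep _] xI; have := separation_mem x sep; rewrite xI orbT !inE => /andP[_ ->].
Qed.

Lemma mc_nbrI e x y : minimal_cut e -> x \in I -> nbr e x y ->
  [|| y \in I, y == u | y == w].
Proof.
move=> mc xI xy; have [_ yV] := nbr_in (rr_digraph (mc_rr mc)) xy.
case: (regionP mc yV) => [[] -> | // | yJ _ _]; rewrite ?eqxx ?orbT //.
by have /andP[] := mc_IJ mc xI yJ; rewrite xy.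
Qed.

Lemma mc_IJ_notuw e x : minimal_cut e -> (x \in I) || (x \in J) -> (x != u) && (x != w).
Proof.
move=> [_ _ _ _ sep _]; rewrite -(separation_mem x sep) !inE negb_or.
by case/andP.
Qed.

(* Otherwise J and whichever of u, w remain lie on one side of the cut {j, k},
   and the other side is properly contained in I. *)
Lemma mc_no_cut_pair e j k : minimal_cut e -> j \in I -> k \in V -> j != k ->
  [|| k \in I, k == u | k == w] -> conn (nbr e) (V :\: [set j; k]).
Proof.
move=> mc jI kV jk kreg; apply: contraT => /connPn[A0 [B0 sep0]].
have [rr uV wV uw sepI minI] := mc; have [eV c2 _ _ _ _] := rr.
have [jV jJ] := mc_IV mc jI.
have /andP[ju jw] : (j != u) && (j != w) by apply: (mc_IJ_notuw mc); rewrite jI.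
have kJ : k \notin J.
  apply/negP => kJ; have /andP[ku kw] := mc_IJ_notuw mc (introT orP (or_intror kJ)).
  case/or3P: kreg => [kI | /eqP kE | /eqP kE]; [exact: (separation_disj sepI kI kJ) | |].
    by rewrite kE eqxx in ku.
  by rewrite kE eqxx in kw.
have uwmem x : x \in V :\: [set j; k] -> [&& x \in V, x != j & x != k].
  by rewrite !inE negb_or => /andP[/andP[-> ->] ->].
(* If the member of {u, w} other than t is neither in A nor equal to k, then t is the only possible
   way out of the intersection of J and A, since j lies in I and so has no neighbour in J. A
   nonempty intersection would make t a separating vertex. *)
have JA A B t : separation (nbr e) (V :\: [set j; k]) A B -> (t = u) \/ (t = w) ->
    t \notin J -> (u != t -> (u \notin A) && (u != k)) ->
    (w != t -> (w \notin A) && (w != k)) -> J :&: A = set0.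
  move=> sep tuw tJ hu hw; apply/eqP; apply: contraT => JA0.
  have AV : A \subset V.
    by apply/subsetP => x xA; have := separation_mem x sep; rewrite xA => /uwmem/and3P[].
  have jA : j \notin A.
    by apply/negP => jA; have := separation_mem j sep; rewrite jA => /uwmem; rewrite eqxx andbF.
  case: (@no_cutvertex e (J :&: A) t j c2) => //.
  - by apply: subset_trans AV; apply: subsetIr.
  - by case: tuw => ->.
  - by rewrite inE (negPf tJ).
  - by rewrite inE (negPf jA) andbF.
  - by case: tuw => ->.
  move=> x y; rewrite !inE => /andP[xJ xA] yV xy.
  have [-> | yt] := eqVneq y t; [by right | left].
  have yj : y != j.
    by apply: contraTneq xy => ->; have /andP[] := mc_IJ mc jI xJ.
  have yI : y \notin I by apply: contraTN xy => yI; have /andP[] := mc_IJ mc yI xJ.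
  have yk : y != k.
    case/or3P: kreg => [kI | /eqP kE | /eqP kE].
    - by apply: contraNneq yI => ->.
    - have [ut | /hu/andP[_]] := eqVneq u t; first by rewrite kE ut.
      by rewrite kE eqxx.
    - have [wt | /hw/andP[_]] := eqVneq w t; first by rewrite kE wt.
      by rewrite kE eqxx.
  have : y \in V :\: [set j; k] by rewrite !inE negb_or yj yk.
  rewrite (separation_mem y sep) => /orP[yA | yB]; last first.
    by have [_ _ _ _ /(_ x y xA yB)] := sep; rewrite xy.
  rewrite yA andbT; case: (regionP mc yV) yt yA yI => // [] [] -> yt yA _.
    by have := hu yt; rewrite yA.
  by have := hw yt; rewrite yA.
have uJ : u \notin J by apply/negP => uJ; have := @mc_IJ_notuw e u mc; rewrite uJ orbT eqxx => /(_ isT).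
have wJ : w \notin J by apply/negP => wJ; have := @mc_IJ_notuw e w mc; rewrite wJ orbT eqxx andbF => /(_ isT).
(* A side that avoids u and w also misses J, so it lies in I without j and is smaller than I. *)
have avoid A B : separation (nbr e) (V :\: [set j; k]) A B -> u \notin A -> w \notin A -> False.
  move=> sep uA wA; have JA0 : J :&: A = set0.
    have [kw | kw] := eqVneq k w.
      by apply: (JA A B w) => //; [right | rewrite kw uA uw | rewrite eqxx].
    apply: (JA A B u) => //; [by left | by rewrite eqxx | by move=> _; rewrite wA eq_sym kw].
  have AI : A \subset I :\ j.
    apply/subsetP => x xA; have := separation_mem x sep; rewrite xA => /uwmem/and3P[xV xj _].
    rewrite !inE xj; case: (regionP mc xV) => // [[] xE | xJ _ _].
    - by rewrite -xE xA in uA.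
    - by rewrite -xE xA in wA.
    - by have := in_set0 x; rewrite -JA0 inE xJ xA.
  have := leq_trans (minI j k A B jV kV jk sep) (subset_leq_card AI).
  by rewrite (cardsD1 j I) jI add1n ltnn.
have sym := separationC (nbr_sym e).
(* When u and w lie on different sides, both sides miss J, although J is nonempty and contains
   neither j nor k. *)
have main A B : separation (nbr e) (V :\: [set j; k]) A B -> u \in A -> w \in B -> False.
  move=> sep uA wB.
  have uB : u \notin B by apply/negP; apply: separation_disj sep uA.
  have wA : w \notin A by apply/negP => wA; apply: separation_disj sep wA wB.
  have /uwmem/and3P[_ _ uk] : u \in V :\: [set j; k] by rewrite (separation_mem u sep) uA.
  have /uwmem/and3P[_ _ wk] : w \in V :\: [set j; k] by rewrite (separation_mem w sep) wB orbT.
  have JA0 : J :&: A = set0.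
    by apply: (JA A B u) => //; [left | rewrite eqxx | rewrite wA wk].
  have JB0 : J :&: B = set0.
    by apply: (JA B A w) => //; [exact: sym | right | rewrite uB uk | rewrite eqxx].
  have [_ /set0Pn[x xJ] _ _ _] := sepI; have xV := mc_JV mc xJ.
  have : x \in V :\: [set j; k].
    rewrite !inE negb_or xV andbT; apply/andP; split.
      by apply: contraNneq jJ => <-.
    by apply: contraNneq kJ => <-.
  rewrite (separation_mem x sep) => /orP[xA | xB].
    by have := in_set0 x; rewrite -JA0 inE xJ xA.
  by have := in_set0 x; rewrite -JB0 inE xJ xB.
have [uA | uA] := boolP (u \in A0); have [wA | wA] := boolP (w \in A0).
- by case: (avoid _ _ (sym _ _ _ sep0)); apply/negP => h; apply: separation_disj sep0 _ h.
- have [wB | wB] := boolP (w \in B0); first by case: (main _ _ sep0).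
  by case: (avoid _ _ (sym _ _ _ sep0)) => //; apply/negP => h; apply: separation_disj sep0 _ h.
- have [uB | uB] := boolP (u \in B0); first by case: (main _ _ (sym _ _ _ sep0)).
  by case: (avoid _ _ (sym _ _ _ sep0)) => //; apply/negP => h; apply: separation_disj sep0 _ h.
- by case: (avoid _ _ sep0).
Qed.

Lemma mc_rule e a b z : minimal_cut e -> a \in I -> a != b ->
  e z a && e z b || e a z && e b z -> [|| b \in I, b == u | b == w] ->
  e a b /\ e b a.
Proof.
move=> mc aI ab h breg; apply: (rr_rule2 (mc_rr mc) h ab).
apply: mc_no_cut_pair => //; have eV := rr_digraph (mc_rr mc).
by case/orP: h => /andP[_ /eV[]].
Qed.

(** If one of u, w had no neighbour in a side, the other alone would cut off that side. *)
Lemma mc_nbr_sides e t : minimal_cut e -> t = u \/ t = w ->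
  (exists2 x, x \in I & nbr e t x) /\ (exists2 x, x \in J & nbr e t x).
Proof.
move=> mc tuw; have [rr uV wV uw sep minI] := mc; have [eV c2 _ _ _ _] := rr.
have [t' [t'uw tt' tV t'V]] : exists t', [/\ forall y, y = u \/ y = w -> y = t \/ y = t',
    t != t', t \in V & t' \in V].
  case: tuw => ->; [exists w | exists u]; split=> //; rewrite 1?eq_sym //.
  by move=> y []; [right | left].
have nI x : x = u \/ x = w -> x \notin I.
  by move=> xuw; apply/negP => xI; have := @mc_IJ_notuw e x mc; rewrite xI => /(_ isT) /andP[/eqP h1 /eqP h2]; case: xuw.
have nJ x : x = u \/ x = w -> x \notin J.
  by move=> xuw; apply/negP => xI; have := @mc_IJ_notuw e x mc; rewrite xI orbT => /(_ isT) /andP[/eqP h1 /eqP h2]; case: xuw.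
have t'uw' : t' = u \/ t' = w.
  case: tuw tt' t'uw => -> tt' t'uw.
    by case: (t'uw w); [right | move=> wu; rewrite wu eqxx in uw | right].
  by case: (t'uw u); [left | move=> wu; rewrite wu eqxx in uw | left].
have [I0 J0 _ _ nIJ] := sep.
split; apply/exists_inP; apply: contraT => /exists_inPn no.
  case: (@no_cutvertex e I t' t c2) => //; first by apply/subsetP => x /(mc_IV mc)[].
    exact: nI.
    exact: nI.
  move=> x y xI yV xy; have := mc_nbrI mc xI xy.
  case/or3P=> [-> | /eqP yE | /eqP yE]; first by left.
    case: (t'uw y (or_introl yE)) => yt; last by right.
    by have := no x xI; rewrite /nbr orbC -yt -/(nbr e x y) xy.
  case: (t'uw y (or_intror yE)) => yt; last by right.
  by have := no x xI; rewrite /nbr orbC -yt -/(nbr e x y) xy.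
case: (@no_cutvertex e J t' t c2) => //; first by apply/subsetP => x /(mc_JV mc).
  exact: nJ.
  exact: nJ.
move=> x y xJ yV xy; case: (regionP mc yV) => [yuw | yI _ _ | yJ _ _]; last by left.
  case: (t'uw y yuw) => yt; last by right.
  by have := no x xJ; rewrite /nbr orbC -yt -/(nbr e x y) xy.
by have /andP[_] := mc_IJ mc yI xJ; rewrite xy.
Qed.

Lemma mc_pair_side e i : minimal_cut e -> 2 <= d -> i \in I ->
  (forall y, e y i -> y = u \/ y = w) ->
  [/\ d = 2, outn e i = [set u; w] & outn (opp e) i = [set u; w]].
Proof.
move=> mc d2 iI iin; have [rr uV wV uw sep minI] := mc.
have [eV c2 dout din _ _] := rr; have [iV _] := mc_IV mc iI.
have ininc : outn (opp e) i \subset [set u; w].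
  by apply/subsetP => y; rewrite !inE => /iin[] ->; rewrite eqxx ?orbT.
have uw2 : #|[set u; w]| = 2 by rewrite cards2 uw.
have dE : d = 2.
  by apply/eqP; rewrite eqn_leq d2 -(din i iV) -uw2 subset_leq_card.
have inE' : outn (opp e) i = [set u; w].
  by apply/eqP; rewrite eqEcard ininc uw2 din // dE.
split=> //; apply/eqP; rewrite eqEcard uw2 dout // dE leqnn andbT.
(* Suppose i has an out-neighbour k in I. The second in-neighbour k' of k forms a digon with i,
   hence is u or w, and then a digon with k. As d = 2, k' has no neighbours but i and k, against its
   having a neighbour in J. *)
apply/subsetP => k; rewrite inE => ik; rewrite !inE.
have kreg := mc_nbrI mc iI (introT orP (or_introl ik) : nbr e i k).
case/orP: (kreg) => // kI; have [kV _] := mc_IV mc kI.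
have nik : i != k by have [] := eV _ _ ik.
have [k' k'i kin] : exists2 k', k' != i & outn (opp e) k = [set i; k'].
  by apply: set2_of_card2; rewrite ?din // inE.
have k'k : e k' k.
  have : k' \in outn (opp e) k by rewrite kin !inE eqxx orbT.
  by rewrite inE.
have k'reg := mc_nbrI mc kI (introT orP (or_intror k'k) : nbr e k k').
have [ik' k'i'] : e i k' /\ e k' i.
  by apply: (mc_rule mc iI _ (z := k)) => //; rewrite 1?eq_sym // ik k'k orbT.
have tuw := iin k' k'i'.
have [k'V _ _] := eV _ _ k'i'.
have nkk' : k != k' by have [_ _] := eV _ _ k'k; rewrite eq_sym.
have [kk' _] : e k k' /\ e k' k.
  by apply: (mc_rule mc kI _ (z := i)) => //; rewrite ik ik'.
have ik2 : #|[set i; k]| = 2 by rewrite cards2 nik.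
have oE : outn e k' = [set i; k].
  by apply/esym/eqP; rewrite eqEcard ik2 dout // dE leqnn andbT subUset !sub1set !inE k'i' k'k.
have iE : outn (opp e) k' = [set i; k].
  by apply/esym/eqP; rewrite eqEcard ik2 din // dE leqnn andbT subUset !sub1set !inE /opp ik' kk'.
have [_ [x xJ]] := mc_nbr_sides mc tuw.
have : nbr e k' x -> x \in [set i; k].
  by case/orP => h; [rewrite -oE | rewrite -iE]; rewrite inE.
move=> h /h; rewrite !inE => /orP[] /eqP xE; rewrite xE in xJ.
  by case: (separation_disj sep iI xJ).
by case: (separation_disj sep kI xJ).
Qed.

(** The vertices of I joined to t by a digon form a set S that is closed under adjacency inside I,
    because a digon makes the rule applicable in either direction. If S were a proper subset, it
    would be a smaller side of the cut {u, w}. *)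
Lemma mc_side_digon e t : minimal_cut e -> t = u \/ t = w ->
  (forall i, i \in I -> exists2 y, y \in I & e y i) ->
  (forall i, i \in I -> exists2 y, y \in I & e i y) ->
  {in I, forall j, e t j && e j t}.
Proof.
move=> mc tuw iin iout; have [rr uV wV uw sep minI] := mc; have eV := rr_digraph rr.
have treg : [|| t \in I, t == u | t == w] by case: tuw => ->; rewrite eqxx ?orbT.
have nt j : j \in I -> j != t.
  by move=> jI; have := mc_IJ_notuw mc (introT orP (or_introl jI)) => /andP[]; case: tuw => ->.
pose S := [set j in I | e t j && e j t].
have S0 : S != set0.
  have [[i iI /orP[ti|it]] _] := mc_nbr_sides mc tuw; apply/set0Pn.
    have [j jI ji] := iin i iI; exists j; rewrite inE jI.
    by have [-> ->] : e j t /\ e t j by apply: (mc_rule mc jI (nt j jI) (z := i)) => //; rewrite ti ji orbT.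
  have [j jI ij] := iout i iI; exists j; rewrite inE jI.
  by have [-> ->] : e j t /\ e t j by apply: (mc_rule mc jI (nt j jI) (z := i)) => //; rewrite it ij.
have Scl j k : j \in S -> k \in I -> nbr e j k -> k \in S.
  rewrite !inE => /andP[jI /andP[tj jt]] kI jk; rewrite kI.
  have [-> ->] // : e k t /\ e t k.
  apply: (mc_rule mc kI (nt k kI) (z := j)) => //.
  by case/orP: jk => ->; rewrite ?tj ?jt ?orbT.
have SI : S \subset I by apply/subsetP => x; rewrite inE => /andP[].
have SE : S = I.
  apply/eqP; rewrite eqEcard SI; apply: (minI u w S (V :\: [set u; w] :\: S)) => //.
  have VI x : x \in V :\: [set u; w] = (x \in I) || (x \in J) by apply: separation_mem sep.
  have [I0 /set0Pn[y yJ] _ IJV nIJ] := sep; split=> //.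
  - apply/set0Pn; exists y; rewrite in_setD VI yJ orbT andbT.
    by apply/negP => /(subsetP SI) yI; apply: separation_disj sep yI yJ.
  - by apply/setP => x; rewrite in_setI in_setD; case: (x \in S); rewrite ?in_set0.
  - apply/setP => x; rewrite in_setU in_setD; case xS: (x \in S) => //=.
    by rewrite VI (subsetP SI).
  move=> x z xS; rewrite in_setD VI => /andP[zS /orP[zI | zJ]].
    by apply: contraNN zS; apply: Scl.
  exact: nIJ (subsetP SI x xS) zJ.
by move=> j; rewrite -SE inE => /andP[].
Qed.

(** Take j in I and a neighbour a of u in J. They are not adjacent, so by the rule {j, a} is a cut.
    The digons put u, the rest of I and w on one side, so the other side is attached only through a,
    which would be a separating vertex. *)
Lemma mc_no_caseB e : minimal_cut e ->
  (forall i, i \in I -> exists2 y, y \in I & e y i) ->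
  (forall i, i \in I -> exists2 y, y \in I & e i y) -> False.
Proof.
move=> mc iin iout; have [rr uV wV uw sep minI] := mc; have [eV c2 _ _ _ _] := rr.
have du := mc_side_digon mc (or_introl erefl) iin iout.
have dw := mc_side_digon mc (or_intror erefl) iin iout.
have [_ [a aJ ua]] := mc_nbr_sides mc (or_introl erefl).
have [/set0Pn[j jI] _ _ _ nIJ] := sep.
have aV := mc_JV mc aJ; have [jV jJ] := mc_IV mc jI.
have ja : j != a by apply: contraNneq jJ => ->.
have /andP[uj ju] := du j jI.
have [cja | /connPn[A0 [B0 sep0]]] := boolP (conn (nbr e) (V :\: [set j; a])).
  have [ja' _] : e j a /\ e a j.
    by apply: (rr_rule2 rr (z := u)) => //; case/orP: ua => ->; rewrite ?uj ?ju ?orbT.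
  by have /andP[] := mc_IJ mc jI aJ; rewrite /nbr ja'.
(* A second vertex of I is needed to connect u with w once j is deleted. *)
have [j' j'I j'j] := iin j jI.
have nj'j : j' != j by have [] := eV _ _ j'j.
have ndA A B : separation (nbr e) (V :\: [set j; a]) A B -> u \in B -> False.
  move=> sepA uB; have [A0' _ _ _ nAB] := sepA.
  have uw_not x : x \in J -> (x != u) && (x != w).
    by move=> xJ; apply: (mc_IJ_notuw mc); rewrite xJ orbT.
  have uw_notI x : x \in I -> (x != u) && (x != w).
    by move=> xI; apply: (mc_IJ_notuw mc); rewrite xI.
  have nIa x : x \in I -> x != a.
    by move=> xI; have [_] := mc_IV mc xI; apply: contraNneq => ->.
  have side x y : x \in B -> y \in V -> y != j -> y != a -> nbr e x y -> y \in B.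
    move=> xB yV yj ya xy; have : y \in V :\: [set j; a] by rewrite !inE negb_or yj ya.
    rewrite (separation_mem y sepA) => /orP[yA | //].
    by have := nAB y x yA xB; rewrite nbr_sym xy.
  have IB x : x \in I -> x != j -> x \in B.
    move=> xI xj; have [xV _] := mc_IV mc xI; apply: (side u) => //; first exact: nIa.
    by rewrite /nbr; have /andP[-> _] := du x xI.
  have wB : w \in B.
    apply: (side j') => //; first exact: IB.
    - by rewrite eq_sym; have /andP[] := uw_notI j jI.
    - by rewrite eq_sym; have /andP[] := uw_not a aJ.
    - by rewrite /nbr; have /andP[_ ->] := dw j' j'I.
  have Anot x : x \in A -> [&& x \in V, x != j, x != a & x \notin B].
    move=> xA; have := separation_mem x sepA; rewrite xA !inE negb_or => /andP[/andP[-> ->] ->] /=.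
    by apply/negP => xB; apply: separation_disj sepA xA xB.
  case: (@no_cutvertex e A a j c2) => //.
  - by apply/subsetP => x /Anot/and4P[].
  - by apply/negP => /Anot; rewrite eqxx !andbF.
  - by apply/negP => /Anot; rewrite eqxx !andbF.
  move=> x y xA yV xy; have [-> | ya] := eqVneq y a; [by right | left].
  have [xV xj xa xB] := and4P (Anot x xA).
  have yj : y != j.
    apply: contraNneq xB => yj; rewrite yj nbr_sym in xy.
    by case/or3P: (mc_nbrI mc jI xy) => [xI | /eqP -> | /eqP ->] //; apply: IB.
  have : y \in V :\: [set j; a] by rewrite !inE negb_or yj ya.
  rewrite (separation_mem y sepA) => /orP[// | yB].
  by have := nAB x y xA yB; rewrite xy.
have : u \in V :\: [set j; a].
  rewrite !inE uV andbT negb_or eq_sym; have /andP[-> _] := @mc_IJ_notuw e j mc (introT orP (or_introl jI)).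
  by rewrite eq_sym; have /andP[-> _] := @mc_IJ_notuw e a mc (introT orP (or_intror aJ)).
rewrite (separation_mem u sep0) => /orP[uA | uB]; last exact: ndA sep0 uB.
by apply: ndA (separationC (nbr_sym e) sep0) uA.
Qed.

End MinimalCut.
End Structure.

(** Let r and s be the out-neighbour and the in-neighbour of u besides i. If r and s differ, each of
    them other than w forms with i a cut between u and w; these cuts contradict an arc between u and
    w or, taken together, make i a separating vertex. Hence r = s. *)
Lemma digon_next (U : finType) (V : {set U}) (e : rel U) i u w : regular_rule V e 2 -> i \in V -> u != w ->
  outn e i = [set u; w] -> outn (opp e) i = [set u; w] ->
  (exists2 z, z \in V & [&& z != i, z != u & z != w]) ->
  forall x, e u x = e x u.
Proof.
move=> rr iV uw oi ii [z zV /and3P[zi zu zw]].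
have [eV c2 dout din _ _] := rr.
have iN x : e i x = (x == u) || (x == w) by have := in_set2 x u w; rewrite -oi inE.
have Ni x : e x i = (x == u) || (x == w) by have := in_set2 x u w; rewrite -ii inE.
have [_ uV niu] : [/\ i \in V, u \in V & i != u] by apply: eV; rewrite iN eqxx.
have [_ wV niw] : [/\ i \in V, w \in V & i != w] by apply: eV; rewrite iN eqxx orbT.
have [r ri oE] : exists2 r, r != i & outn e u = [set i; r].
  by apply: set2_of_card2; rewrite ?dout // inE Ni eqxx.
have [s si iE] : exists2 s, s != i & outn (opp e) u = [set i; s].
  by apply: set2_of_card2; rewrite ?din // inE /opp iN eqxx.
have ur : e u r by have := set22 i r; rewrite -oE inE.
have su : e s u by have := set22 i s; rewrite -iE inE.
have [rs | rs] := eqVneq r s.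
  move=> x; have : (x \in outn e u) = (x \in outn (opp e) u) by rewrite oE iE rs.
  by rewrite !inE.
have [_ rV nur] := eV _ _ ur; have [sV _ nsu] := eV _ _ su.
pose K t := V :\: [set i; t].
have inK t x : (x \in K t) = [&& x != i, x != t & x \in V] by rewrite !inE negb_or andbA.
(* The only neighbours of i are u and w. A side containing neither would be attached only through
   t. *)
have side t A B : t \in V -> t != i -> t != u -> t != w -> separation (nbr e) (K t) A B -> u \in A -> w \in B.
  move=> tV ti tu tw sep uA; apply: contraT => wB.
  have [_ B0 _ _ nAB] := sep.
  have BV x : x \in B -> [&& x != i, x != t & x \in V].
    by move=> xB; rewrite -inK (separation_mem x sep) xB orbT.
  case: (@no_cutvertex U V e B t i c2) => //.
  - by apply/subsetP => x /BV/and3P[].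
  - by apply/negP => /BV; rewrite eqxx andbF.
  - by apply/negP => /BV; rewrite eqxx.
  - by rewrite eq_sym.
  move=> x y xB yV xy; have [-> | yt] := eqVneq y t; [by right | left].
  have yi : y != i.
    apply: contraNneq wB => yi; move: xy; rewrite yi /nbr Ni iN orbb => /orP[] /eqP xE.
      by case: (separation_disj sep uA); rewrite -xE.
    by rewrite -xE.
  have : y \in K t by rewrite inK yi yt.
  rewrite (separation_mem y sep) => /orP[yA | //].
  by have := nAB y x yA xB; rewrite nbr_sym xy.
(* Here i and t are common out-neighbours or in-neighbours of u but are not adjacent, so the rule
   makes {i, t} a cut. *)
have cut t : t \in V -> t != i -> t != u -> t != w ->
    e u i && e u t || e i u && e t u ->
    exists A B, [/\ separation (nbr e) (K t) A B, u \in A & w \in B].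
  move=> tV ti tu tw h; have it : i != t by rewrite eq_sym.
  have [ct | /connPn[A [B sep]]] := boolP (conn (nbr e) (K t)).
    have [] := rr_rule2 rr h it ct; by rewrite iN (negPf tu) (negPf tw).
  have : u \in K t by rewrite inK eq_sym niu eq_sym tu uV.
  rewrite (separation_mem u sep) => /orP[uA | uB].
    by exists A, B; split=> //; apply: side sep uA.
  have sep' := separationC (nbr_sym e) sep.
  by exists B, A; split=> //; apply: side sep' uB.
have nadj t A B : separation (nbr e) (K t) A B -> u \in A -> w \in B -> ~~ nbr e u w.
  by move=> [_ _ _ _ nAB] uA wB; apply: nAB.
have ui : e u i by rewrite Ni eqxx.
have iu : e i u by rewrite iN eqxx.
have rcut : r != w -> exists A B, [/\ separation (nbr e) (K r) A B, u \in A & w \in B].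
  by move=> rw; apply: cut => //; [rewrite eq_sym | rewrite ui ur].
have scut : s != w -> exists A B, [/\ separation (nbr e) (K s) A B, u \in A & w \in B].
  by move=> sw; apply: cut => //; rewrite iu su orbT.
have [rw | rw] := eqVneq r w.
  have [|A [B [sep uA wB]]] := scut; first by rewrite -rw eq_sym.
  by have := nadj _ _ _ sep uA wB; rewrite /nbr -rw ur.
have [sw | sw] := eqVneq s w.
  have [|A [B [sep uA wB]]] := rcut; first by [].
  by have := nadj _ _ _ sep uA wB; rewrite /nbr -sw su orbT.
(* Being adjacent to u, s lies on its side of the cut {i, r}, and r on its side of the cut {i, s}.
   So neither r nor s is adjacent to the intersection of B1 and B2, which can be left only through
   i. *)
have [A1 [B1 [sep1 uA1 wB1]]] := rcut rw; have [A2 [B2 [sep2 uA2 wB2]]] := scut sw.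
have [_ _ _ _ n1] := sep1; have [_ _ _ _ n2] := sep2.
have sA1 : s \in A1.
  have : s \in K r by rewrite inK si eq_sym rs.
  rewrite (separation_mem s sep1) => /orP[// | sB].
  by have := n1 u s uA1 sB; rewrite /nbr su orbT.
have rA2 : r \in A2.
  have : r \in K s by rewrite inK ri rs.
  rewrite (separation_mem r sep2) => /orP[// | rB].
  by have := n2 u r uA2 rB; rewrite /nbr ur.
have BV x : x \in B1 :&: B2 -> [&& x != i, x != u & x \in V].
  rewrite inE => /andP[x1 x2]; have := separation_mem x sep1.
  rewrite x1 orbT inK => /and3P[-> _ ->]; rewrite andbT /=.
  by apply: contraTneq x1 => ->; apply/negP; apply: separation_disj sep1 uA1.
case: (@no_cutvertex U V e (B1 :&: B2) i u c2) => //.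
- by apply/subsetP => x /BV/and3P[].
- by apply/set0Pn; exists w; rewrite inE wB1.
- by apply/negP => /BV; rewrite eqxx.
- by apply/negP => /BV; rewrite eqxx andbF.
- by rewrite eq_sym.
move=> x y; rewrite !inE => /andP[x1 x2] yV xy.
have [-> | yi] := eqVneq y i; [by right | left].
have step t A B : separation (nbr e) (K t) A B -> x \in B -> y != t -> y \in B.
  move=> sep xB yt; have : y \in K t by rewrite inK yi yt.
  rewrite (separation_mem y sep) => /orP[yA | //]; have [_ _ _ _ n] := sep.
  by have := n y x yA xB; rewrite nbr_sym xy.
have [yr | yr] := eqVneq y r.
  have yB2 : y \in B2 by apply: step sep2 x2 _; rewrite yr.
  by case: (separation_disj sep2 rA2); rewrite -yr.
have y1 := step _ _ _ sep1 x1 yr; rewrite y1.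
apply: step sep2 x2 _; apply: contraTneq y1 => ->; apply/negP.
exact: separation_disj sep1 sA1.
Qed.

Lemma regular_structure (U : finType) (V : {set U}) (e : rel U) d : regular_rule V e d -> conn (nbr e) V -> 2 <= d ->
  {in V &, forall u v, u != v -> e u v} \/ (d = 2 /\ symmetric e).
Proof.
move=> rr cV d2; have [eV c2 dout din _ _] := rr.
(* Cuts are encoded as boolean triples of two vertices and one side, so that a side of minimum size
   can be selected over all cuts at once. *)
pose cut (p : U * U * {set U}) := [&& p.1.1 \in V, p.1.2 \in V, p.1.1 != p.1.2,
  p.2 \subset V :\: [set p.1.1; p.1.2], p.2 != set0,
  p.2 != V :\: [set p.1.1; p.1.2] & closed_in (nbr e) (V :\: [set p.1.1; p.1.2]) p.2].
have cut_sep j k A B : j \in V -> k \in V -> j != k ->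
    separation (nbr e) (V :\: [set j; k]) A B -> cut (j, k, A).
  move=> jV kV jk sep; have [A0 /set0Pn[b bB] _ E nAB] := sep.
  rewrite /cut /= jV kV jk A0 -E subsetUl /=; apply/andP; split.
    apply: contraTneq bB => AE; apply/negP => bB; apply: (separation_disj sep _ bB).
    by rewrite AE inE bB orbT.
  apply/closed_inP => x y xA; rewrite inE => /orP[// | yB] xy.
  by have := nAB x y xA yB; rewrite xy.
have [c3 | ] := boolP [forall a in V, forall b in V, (a != b) ==> conn (nbr e) (V :\: [set a; b])].
  left; apply: complete_of_3conn rr cV d2 _ => a b aV bV ab.
  by have /forall_inP/(_ b bV)/implyP := forall_inP c3 a aV; apply.
rewrite negb_forall_in => /exists_inP[a aV]; rewrite negb_forall_in => /exists_inP[b bV].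
rewrite negb_imply => /andP[ab /connPn[A [B sepab]]].
right; case: (arg_minnP (fun p : U * U * {set U} => #|p.2|) (cut_sep _ _ _ _ aV bV ab sepab)).
move=> [[u w] I] /and5P[/= uV wV uw IK /and3P[I0 IE /closed_inP Icl]] minI.
pose J := V :\: [set u; w] :\: I.
have mc : minimal_cut V d u w I J e.
  split=> // [|j k A' B' jV kV jk /(cut_sep _ _ _ _ jV kV jk)]; last exact: minI.
  split=> //.
  - by rewrite setD_eq0; apply: contraNN IE => KI; rewrite eqEsubset IK.
  - by apply/setP => x; rewrite /J in_set0 in_setI in_setD; case: (x \in I).
  - apply/setP => x; rewrite /J in_setU in_setD; case: (boolP (x \in I)) => [xI | //].
    by rewrite (subsetP IK x xI).
  - by move=> x y xI /setDP[yK]; apply: contraNN; apply: Icl.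
have mc' : minimal_cut V d u w I J (opp e).
  have [_ _ _ _ [_ J0 IJ0 IJV nIJ] mn] := mc.
  have nop x y : nbr (opp e) x y = nbr e x y by rewrite /nbr /opp orbC.
  split=> //; first exact: regular_rule_opp.
    by split=> // x y xI yJ; rewrite nop nIJ.
  move=> j k A' B' jV kV jk [A0 B0 AB ABV nAB]; apply: (mn j k A' B') => //.
  by split=> // x y xA yB; rewrite -nop nAB.
have [i iI [dE oi ii]] : exists2 i, i \in I &
    [/\ d = 2, outn e i = [set u; w] & outn (opp e) i = [set u; w]].
  apply: NNPP => no.
  have nbrI i y : i \in I -> nbr e i y -> y \notin I -> y = u \/ y = w.
    move=> iI iy yI; have := mc_nbrI mc iI iy; rewrite (negPf yI) /=.
    by case/orP=> /eqP; [left | right].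
  (* A vertex of I without in-neighbours in I is the wanted one by [mc_pair_side]; one without
     out-neighbours in I is so by the same lemma for the reversed relation. *)
  apply: (mc_no_caseB mc) => i iI; apply/exists_inP; apply: contraT => /exists_inPn none; case: no; exists i => //.
    apply: (mc_pair_side mc d2 iI) => y yi; apply: (nbrI i) => //; first by rewrite /nbr yi orbT.
    by apply: contraTN yi; apply: none.
  have [|dE oi ii] := mc_pair_side mc' d2 iI; last by split.
  move=> y iy; apply: (nbrI i) => //; first by rewrite /nbr; move: iy; rewrite /opp => ->.
  by apply: contraTN iy; apply: none.
have [iV _] := mc_IV mc iI; split=> //.
have four v a' b' : exists2 z, z \in V & [&& z != v, z != a' & z != b'].
  have [_ /set0Pn[x xJ] _ _ _] := mc_sep mc.
  have [/andP[xu xw] /andP[iu iw]] := (mc_IJ_notuw mc (introT orP (or_intror xJ)),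
    mc_IJ_notuw mc (introT orP (or_introl iI))).
  have ix : i != x by apply: contraTneq xJ => <-; have [] := mc_IV mc iI.
  have c4 : #|[set i; x; u; w]| = 4.
    rewrite -!setUA cardsU1 cardsU1 cards2 !inE !negb_or.
    by rewrite ix iu iw xu xw uw.
  have sub4 : [set i; x; u; w] \subset V.
    by rewrite !subUset !sub1set iV uV wV (mc_JV mc xJ).
  have : ~~ (V \subset [set v; a'; b']).
    apply/negP => /subset_leq_card/(leq_trans (subset_leq_card sub4)); rewrite c4.
    by rewrite -setUA cardsU1 cards2; case: (_ \notin _); case: (_ != _).
  case/subsetPn => z zV; rewrite !inE !negb_or -andbA => zz; by exists z.
rewrite dE in rr dout din.
(* Z collects the vertices all of whose arcs lie in digons. It contains i, and [digon_next] carries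
   membership to every neighbour. *)
pose Z := [set v in V | [forall x, e v x == e x v]].
have ZV : Z = V.
  apply: (conn_closed cV).
  - by apply/subsetP => x; rewrite inE => /andP[].
  - apply/set0Pn; exists i; rewrite inE iV; apply/forallP => x.
    have : (x \in outn e i) = (x \in outn (opp e) i) by rewrite oi ii.
    by rewrite !inE => ->.
  move=> v y; rewrite !inE => /andP[vV /forallP vZ] yV vy; rewrite yV /=.
  have {}vy : e v y by case/orP: vy => //; rewrite (eqP (vZ y)).
  have [y' y'y oE] : exists2 y', y' != y & outn e v = [set y; y'].
    by apply: set2_of_card2; rewrite ?dout // inE.
  apply/forallP => x; apply/eqP; apply: (digon_next rr vV _ oE _ (four _ _ _)).
    by rewrite eq_sym.
  by rewrite -oE; apply/setP => t; rewrite !inE /opp -(eqP (vZ t)).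
move=> x y; have [xV | xV] := boolP (x \in V).
  by move: xV; rewrite -ZV inE => /andP[_ /forallP/(_ y)/eqP].
by apply/idP/idP => /eV[h1 h2 _]; rewrite ?h1 ?h2 in xV.
Qed.

(** * Nonseparable digraphs *)

Lemma conn_connect (U : finType) (r : rel U) (K : {set U}) :
  (forall x y, r x y -> x \in K /\ y \in K) ->
  conn r K <-> {in K &, forall u v, connect r u v}.
Proof.
move=> rK; split=> [cK u v uK vK | cK].
  have : [set x in K | connect r u x] = K.
    apply: (conn_closed cK).
    - by apply/subsetP => x; rewrite inE => /andP[].
    - by apply/set0Pn; exists u; rewrite inE uK connect0.
    - move=> x y; rewrite !inE => /andP[_ ux] -> xy.
      exact: connect_trans ux (connect1 xy).
  by move/setP/(_ v); rewrite inE vK.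
apply: contraT => /connPn[A [B [/set0Pn[x xA] /set0Pn[y yB] AB ABK nAB]]].
have AK z : z \in A -> z \in K by rewrite -ABK inE => ->.
have yK : y \in K by rewrite -ABK inE yB orbT.
have /connectP[p] := cK x y (AK x xA) yK.
elim: p x xA => [|z p IHp] x xA /=; first by move=> _ yx; have := in_set0 y; rewrite -AB inE yB yx xA.
case/andP=> xz pz; apply: IHp pz; have [_] := rK x z xz.
by rewrite -ABK inE => /orP[// | zB]; have := nAB x z xA zB; rewrite xz.
Qed.

Lemma adj_in (U : finType) (D : digraph U) x y :
  adj D x y -> x \in vset D /\ y \in vset D.
Proof. by case/orP => /is_arc_in[]. Qed.

Lemma adj_induced (U : finType) (D : digraph U) (S : {set U}) x y :
  adj (induced D S) x y = [&& adj D x y, x \in S & y \in S].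
Proof.
by rewrite /adj !is_arc_induced; case: (x \in S); case: (y \in S); rewrite ?andbF ?andbT.
Qed.

Lemma conn_induced (U : finType) (D : digraph U) (S K : {set U}) :
  K \subset S -> conn (adj (induced D S)) K = conn (adj D) K.
Proof.
move=> KS; apply: eq_conn => x y xK yK.
by rewrite adj_induced (subsetP KS x xK) (subsetP KS y yK) !andbT.
Qed.

Lemma connectedP (U : finType) (D : digraph U) :
  connected D <-> vset D != set0 /\ conn (adj D) (vset D).
Proof. by split=> -[V0 cD]; split=> //; apply/(conn_connect (@adj_in U D)). Qed.

Lemma vset_del_vertex (U : finType) (D : digraph U) v :
  vset (del_vertex D v) = vset D :\ v.
Proof. by rewrite /= setDE. Qed.

Lemma separatingP (U : finType) (D : digraph U) v : v \in vset D ->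
  separating D v <-> ~~ conn (adj D) (vset D :\ v).
Proof.
move=> vD; have -> : conn (adj D) (vset D :\ v) =
    conn (adj (del_vertex D v)) (vset (del_vertex D v)).
  rewrite vset_del_vertex conn_induced //.
  by apply/subsetP => x; rewrite !inE => /andP[].
split=> [[_ [x [y [xD yD nxy]]]] | nc].
  by apply: contraNN nxy => /(conn_connect (@adj_in U _)); apply.
split=> //; apply: NNPP => no; case/negP: nc.
apply/(conn_connect (@adj_in U _)) => x y xD yD; apply: contraT => nxy.
by case: no; exists x, y.
Qed.

Lemma nonseparableP (U : finType) (D : digraph U) : nonseparable D <->
  [/\ vset D != set0, conn (adj D) (vset D) &
      {in vset D, forall v, conn (adj D) (vset D :\ v)}].
Proof.
split=> [[/connectedP[V0 cD] nos] | [V0 cD c2]].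
  split=> // v vD; apply: contraT => /(separatingP vD) sv.
  by case: nos; exists v.
split; first exact/connectedP.
case=> v sv; have [vD _] := sv.
by have /negP := proj1 (separatingP vD) sv; apply; apply: c2.
Qed.

(** * Recognising the three kinds of nonseparable digraphs *)

Lemma bidirected_completeP (U : finType) (D : digraph U) :
  {in vset D &, forall u v, u != v -> is_arc D u v} -> bidirected_complete D.
Proof.
move=> cD; pose E := [set e : {set U} | (e \subset vset D) && (#|e| == 2)].
have EP : [forall e in E, (e \subset vset D) && (#|e| == 2)].
  by apply/forall_inP => e; rewrite inE.
exists (SGraph EP) => //; split=> // u v.
rewrite inE subUset !sub1set cards2 eqSS eqb1.
by apply/idP/andP => [/is_arc_in[-> -> ->] // | [/andP[uD vD] uv]]; apply: cD.
Qed.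

Lemma dicycle_of_1regular (U : finType) (D : digraph U) v1 v2 :
  v1 \in vset D -> v2 \in vset D -> v1 != v2 -> conn (adj D) (vset D) ->
  {in vset D, forall v, #|outn (is_arc D) v| = 1} ->
  {in vset D, forall v, #|outn (opp (is_arc D)) v| = 1} ->
  exists2 n, 2 <= n & dicycle n D.
Proof.
move=> v1D v2D v12 cD dout din.
pose f v := odflt v [pick w | is_arc D v w].
have fP v : v \in vset D -> is_arc D v (f v).
  move=> vD; rewrite /f; case: pickP => // no.
  have /eqP := dout v vD; rewrite (_ : outn _ v = set0) ?cards0 //.
  by apply/setP => w; rewrite !inE no.
have fU v w : is_arc D v w -> w = f v.
  move=> vw; have [vD _ _] := is_arc_in vw.
  have /eqP/cards1P[x xE] := dout v vD.
  have: w \in outn (is_arc D) v by rewrite inE.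
  have: f v \in outn (is_arc D) v by rewrite inE fP.
  by rewrite xE !inE => /eqP -> /eqP.
(* The default value of f fixes the points outside D, so f is a permutation of the whole carrier and
   its orbits are cycles. *)
have fN v : v \notin vset D -> f v = v.
  by move=> vD; rewrite /f; case: pickP => // w /is_arc_in[vD' _ _]; rewrite vD' in vD.
have finj : injective f.
  move=> x y fxy; have [xD | xD] := boolP (x \in vset D); have [yD | yD] := boolP (y \in vset D).
  - have [_ fD _] := is_arc_in (fP x xD).
    have /eqP/cards1P[z zE] := din (f x) fD.
    have: x \in outn (opp (is_arc D)) (f x) by rewrite inE; apply: fP.
    have: y \in outn (opp (is_arc D)) (f x) by rewrite inE fxy; apply: fP.
    by rewrite zE !inE => /eqP -> /eqP.
  - by have [_] := is_arc_in (fP x xD); rewrite fxy fN // (negPf yD).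
  - by have [_] := is_arc_in (fP y yD); rewrite -fxy fN // (negPf xD).
  - by rewrite -(fN x xD) -(fN y yD).
have VE : [set x in orbit f v1] = vset D.
  apply: (conn_closed cD).
  - apply/subsetP => x; rewrite inE -fconnect_orbit => /iter_findex <-.
    elim: (findex _ _ _) => //= n IHn.
    by have [] := is_arc_in (fP _ IHn).
  - by apply/set0Pn; exists v1; rewrite inE in_orbit.
  - move=> x y; rewrite !inE -!fconnect_orbit => v1x _ /orP[/fU -> | /fU xE].
      exact: connect_trans v1x (fconnect1 f x).
    apply: connect_trans v1x _; rewrite fconnect_sym // xE; exact: fconnect1.
have nx x : x \in orbit f v1 -> next (orbit f v1) x = f x.
  by move=> xo; have /eqP <- := next_cycle (cycle_orbit finj v1) xo.
exists (size (orbit f v1)).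
  have : v1 \in orbit f v1 by exact: in_orbit.
  have : v2 \in orbit f v1 by have := v2D; rewrite -VE inE.
  case: (orbit f v1) => // x [|y s] //; rewrite !inE => /eqP v2x /eqP v1x.
  by rewrite v1x v2x eqxx in v12.
exists (orbit f v1); split=> //.
apply/setP => -[x y]; apply/idP/imsetP => [xy | [z zo [-> ->]]].
  have [xD _ _] := is_arc_in (xy : is_arc D x y).
  have xo : x \in orbit f v1 by move: xD; rewrite -VE inE.
  by exists x => //; rewrite nx // (fU x y).
by rewrite nx //; apply: fP; rewrite -VE inE.
Qed.

Lemma next_next_neq (T : eqType) (s : seq T) x :
  uniq s -> 3 <= size s -> x \in s -> next s (next s x) != x.
Proof.
move=> us s3 /rot_to[i s' sE]; rewrite -!(next_rot i us) sE.
have : uniq (x :: s') by rewrite -sE rot_uniq.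
have : size (x :: s') = size s by rewrite -sE size_rot.
case: s' {sE} => [|y [|z s']] /= sz; try by rewrite -sz in s3.
rewrite !inE !negb_or -!andbA eqxx => /and5P[xy xz _ yz _].
by rewrite [y == x]eq_sym (negPf xy) ?eqxx eq_sym.
Qed.

Lemma next_prev_neq (T : eqType) (s : seq T) x :
  uniq s -> 3 <= size s -> x \in s -> next s x != prev s x.
Proof.
move=> us s3 xs; apply/eqP => E.
by have := next_next_neq us s3 xs; rewrite E next_prev // eqxx.
Qed.

Lemma set2_eq (T : finType) (a b x y : T) : a != b ->
  [set a; b] = [set x; y] -> (a = x /\ b = y) \/ (a = y /\ b = x).
Proof.
move=> ab E; have := set21 a b; have := set22 a b; rewrite E.
case/set2P=> bE /set2P[] aE; rewrite aE bE ?eqxx in ab *; by [| left | right].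
Qed.

Lemma bidirected_cycle_of_2regular (U : finType) (D : digraph U) v1 :
  v1 \in vset D -> conn (adj D) (vset D) ->
  {in vset D, forall v, conn (adj D) (vset D :\ v)} ->
  {in vset D, forall v, #|outn (is_arc D) v| = 2} -> symmetric (is_arc D) ->
  exists2 n, 3 <= n & bidirected_cycle n D.
Proof.
move=> v1D cD c2 dout sD.
have /card_gt0P[u uN] : 0 < #|outn (is_arc D) v1| by rewrite dout.
have [w wu uwE] := set2_of_card2 (dout v1 v1D) uN; have uw : u != w by rewrite eq_sym.
have v1u : is_arc D v1 u by have := set21 u w; rewrite -uwE inE.
have v1w : is_arc D v1 w by have := set22 u w; rewrite -uwE inE.
have [_ uD nv1u] := is_arc_in v1u; have [_ wD nv1w] := is_arc_in v1w.
(* A simple path from u to w avoiding v1 closes up through v1 to a cycle. Its vertices already have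
   both their neighbours on it, so by connectivity it is all of D. *)
pose r x y := [&& adj D x y, x \in vset D :\ v1 & y \in vset D :\ v1].
have rin x y : r x y -> x \in vset D :\ v1 /\ y \in vset D :\ v1 by case/and3P.
have cr : conn r (vset D :\ v1).
  have -> : conn r (vset D :\ v1) = conn (adj D) (vset D :\ v1).
    by apply: eq_conn => x y xK yK; rewrite /r xK yK !andbT.
  exact: c2.
have [uK wK] : u \in vset D :\ v1 /\ w \in vset D :\ v1.
  by rewrite !inE uD wD !andbT ![_ == v1]eq_sym.
have /connectP[p0 p0r] := proj1 (conn_connect rin) cr u w uK wK.
case/shortenP: p0r => p pr pu _ wE {p0}.
have pK x : x \in u :: p -> x \in vset D :\ v1.
  elim: p u uK pr {pu wE v1u uD nv1u uw uwE uN wu} => [|z p IHp] y yK /=.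
    by rewrite inE => _ /eqP ->.
  case/andP=> yz pz; rewrite inE => /orP[/eqP -> // | xp].
  by apply: (IHp z) => //; have [] := rin _ _ yz.
pose s := v1 :: u :: p.
have us : uniq s.
  by rewrite /s cons_uniq pu andbT; apply/negP => /pK; rewrite !inE eqxx.
have s3 : 3 <= size s.
  by rewrite /s; case: p wE {pr pu pK s us} => // /eqP; rewrite eq_sym (negPf uw).
have adjE x y : adj D x y = is_arc D x y by rewrite /adj sD orbb.
have cs : cycle (is_arc D) s.
  rewrite /s /= v1u rcons_path -wE sD v1w andbT.
  by apply: sub_path pr => x y /and3P[]; rewrite adjE.
have sN x : x \in s -> outn (is_arc D) x = [set next s x; prev s x].
  move=> xs; have xD : x \in vset D.
    by move: xs; rewrite inE => /orP[/eqP -> // | /pK /setD1P[]].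
  apply/esym/eqP; rewrite eqEcard cards2 next_prev_neq // dout // andbT.
  by rewrite subUset !sub1set !inE (next_cycle cs xs) sD (prev_cycle cs xs).
have VE : [set x in s] = vset D.
  apply: (conn_closed cD).
  - apply/subsetP => x; rewrite inE => xs; have : next s x \in outn (is_arc D) x.
      by rewrite sN // set21.
    by rewrite inE => /is_arc_in[].
  - by apply/set0Pn; exists v1; rewrite !inE eqxx.
  - move=> x y; rewrite !in_set adjE => xs _ xy.
    have : y \in outn (is_arc D) x by rewrite inE.
    by rewrite sN // => /set2P[] ->; rewrite ?mem_next ?mem_prev.
pose E := [set [set x; next s x] | x in s].
have s2 : 2 <= size s by exact: ltnW.
have EP : [forall e in E, (e \subset vset D) && (#|e| == 2)].
  apply/forall_inP => _ /imsetP[x xs ->]; rewrite cards2 next_neq // andbT.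
  by rewrite subUset !sub1set -VE !in_set mem_next xs.
exists (size s) => //; exists (SGraph EP); first by exists s.
split=> // u' v'; apply/idP/imsetP => [uv | [x xs]].
  have [u'D _ _] := is_arc_in uv.
  have us' : u' \in s by move: u'D; rewrite -VE in_set.
  have : v' \in outn (is_arc D) u' by rewrite inE.
  rewrite sN // => /set2P[] ->; first by exists u'.
  exists (prev s u'); first by rewrite mem_prev.
  by rewrite (next_prev us) setUC.
have xn : is_arc D x (next s x).
  have : next s x \in outn (is_arc D) x by rewrite sN // set21.
  by rewrite inE.
by move/esym/(set2_eq (next_neq us s2 xs)) => [[<- <-] | [<- <-]] //; rewrite sD.
Qed.

Lemma nonseparable_types (U : finType) (D : digraph U) :
  nonseparable D -> ~ dp_degree_colorable D ->
  [\/ exists2 n : nat, 2 <= n & dicycle n D,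
      exists2 n : nat, 3 <= n & bidirected_cycle n D
    | bidirected_complete D].
Proof.
move=> /nonseparableP[V0 cD c2] nD.
have [/exists_inP[v1 v1D /exists_inP[v2 v2D v12]] | no] :=
    boolP [exists v1 in vset D, exists v2 in vset D, v1 != v2]; last first.
  (* A single vertex is a complete graph. *)
  apply: Or33; apply: bidirected_completeP => u v uD vD uv; case/exists_inP: no.
  by exists u => //; apply/exists_inP; exists v.
have [W [X [H [covH deg ncol]]]] : exists (W : finType) (X : U -> {set W}) H,
    [/\ dp_cover D X H, {in vset D, forall v, maxn (outdeg D v) (indeg D v) <= #|X v|}
      & ~ colorable D X H].
  apply: NNPP => no; apply: nD => W X H covH deg; apply: NNPP => ncol.
  by apply: no; exists W, X, H.
have badc : bad_cover (vset D) (is_arc D) X (is_arc H).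
  split=> //; first exact: is_arc_in.
    exact: dp_cover_is_cover.
  by move=> col; apply: ncol; apply/colorableP.
have nbr1 := conn_nbr cD v1D v2D v12.
have Xv1 : 0 < #|X v1|.
  apply: leq_trans (deg v1 v1D); rewrite leq_max /outdeg /indeg.
  have [y yD /orP[v1y | yv1]] := nbr1.
    by apply/orP; left; apply/card_gt0P; exists y; rewrite inE.
  by apply/orP; right; apply/card_gt0P; exists y; rewrite inE.
have [w0 _] := card_gt0P Xv1.
have dX := bad_degree w0 badc cD.
have arcX u a : is_arc D u a -> #|X a| = #|X u|.
  move=> ua; have [uD aD _] := is_arc_in ua; apply/eqP; rewrite eqn_leq.
  rewrite (bad_card_le badc _ (c2 a aD) ua) /=; last by rewrite -(dX u uD).1.
  apply: (bad_card_le (bad_cover_opp badc) (u := a) (a := u)) => //.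
    by rewrite -(dX a aD).2.
  by rewrite nbr_opp; apply: c2.
have dE : {in vset D, forall v, #|X v| = #|X v1|}.
  have E : [set v in vset D | #|X v| == #|X v1|] = vset D.
    apply: (conn_closed cD).
    - by apply/subsetP => x; rewrite inE => /andP[].
    - by apply/set0Pn; exists v1; rewrite inE v1D eqxx.
    - move=> x y; rewrite !inE => /andP[xD /eqP xE] -> /=; rewrite -xE.
      by case/orP => /arcX ->.
  by move=> v; rewrite -{1}E inE => /andP[_ /eqP].
have rr : regular_rule (vset D) (is_arc D) #|X v1|.
  split=> //.
  - exact: is_arc_in.
  - by move=> v vD; rewrite -(dX v vD).1 dE.
  - by move=> v vD; rewrite -(dX v vD).2 dE.
  - by move=> z a b za zb ab; apply: (bad_rule badc c2 dX za zb ab).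
  - move=> z a b za zb ab; apply: (bad_rule (bad_cover_opp badc) _ _ za zb ab).
      by move=> v vD; rewrite nbr_opp; apply: c2.
    by move=> v vD; split; [exact: (dX v vD).2 | exact: (dX v vD).1].
have [d2 | d1] := leqP 2 #|X v1|.
  case: (regular_structure rr cD d2) => [comp | [d2' sD]].
    by apply: Or33; apply: bidirected_completeP.
  apply: Or32; apply: (bidirected_cycle_of_2regular v1D cD c2) => // v vD.
  by rewrite (rr_out rr vD).
have dE1 : #|X v1| = 1 by apply/eqP; rewrite eqn_leq -ltnS d1.
apply: Or31; apply: (dicycle_of_1regular v1D v2D v12 cD) => v vD.
  by rewrite (rr_out rr vD).
by rewrite (rr_in rr vD).
Qed.

(** * Bad covers of the three kinds of blocks *)

(** Compared with [bad_cover], [bc_arc] confines h to colours over arcs of D, which is what allows a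
    cover digraph H to be rebuilt from the relation. *)
Record bad_config (U : finType) (D : digraph U) (W : finType)
    (X : U -> {set W}) (h : rel W) : Prop := BadConfig {
  bc_disj : {in vset D &, forall u v, u != v -> [disjoint X u & X v]};
  bc_arc : forall x y, h x y ->
    exists u v, [/\ is_arc D u v, x \in X u & y \in X v];
  bc_out : forall u v x y z, is_arc D u v ->
    x \in X u -> y \in X v -> z \in X v -> h x y -> h x z -> y = z;
  bc_in : forall u v x y z, is_arc D u v ->
    x \in X v -> y \in X u -> z \in X u -> h y x -> h z x -> y = z;
  bc_deg : {in vset D, forall v, maxn (outdeg D v) (indeg D v) <= #|X v|};
  bc_uncol : uncolorable (vset D) X h
}.

Lemma disjoint_mem (T : finType) (A B : {set T}) x :
  [disjoint A & B] -> x \in A -> x \in B -> False.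
Proof. by move/disjoint_setI0/setP/(_ x); rewrite !inE => E xA xB; rewrite xA xB in E. Qed.

Lemma bad_config_cover (U : finType) (D : digraph U) (W : finType)
    (X : U -> {set W}) (h : rel W) : bad_config D X h ->
  exists2 H : digraph W, dp_cover D X H & is_arc H =2 h.
Proof.
move=> [dX aX oX iX _ _].
have Xinj u v x : u \in vset D -> v \in vset D -> x \in X u -> x \in X v -> u = v.
  move=> uD vD xu xv; apply/eqP; apply: contraT => uv.
  by case: (disjoint_mem (dX u v uD vD uv) xu xv).
pose VH := \bigcup_(v in vset D) X v.
pose AH := [set p : W * W | h p.1 p.2].
have HP : [forall a in AH, [&& a.1 \in VH, a.2 \in VH & a.1 != a.2]].
  apply/forall_inP => -[x y]; rewrite inE /= => /aX[u [v [uv xu yv]]].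
  have [uD vD neuv] := is_arc_in uv.
  apply/and3P; split; [by apply/bigcupP; exists u | by apply/bigcupP; exists v |].
  by apply: contraNneq neuv => xy; rewrite (Xinj u v x) // xy.
pose H := Digraph HP.
have HE : is_arc H =2 h by move=> x y; rewrite /is_arc inE.
exists H => //; split=> //.
- move=> v vD x y xv yv; rewrite HE; apply/negP => /aX[a [b [ab xa yb]]].
  have [aD bD] := is_arc_in ab; rewrite -(Xinj _ _ _ vD aD xv xa).
  by rewrite -(Xinj _ _ _ vD bD yv yb) eqxx.
- move=> u v uv [x y] [x' y']; have [uD vD neuv] := is_arc_in uv.
  rewrite !inE /= => /andP[hxy /andP[xu yv]] /andP[hxy' /andP[xu' yv']] ne.
  have dis a b : a \in X u -> b \in X v -> a != b.
    by move=> au bv; apply: contraNneq neuv => ab; rewrite (Xinj u v a) // ab.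
  have xx : x != x'.
    apply: contraNneq ne => xx; rewrite -xx in hxy' *.
    by rewrite (oX u v x y y').
  have yy : y != y'.
    apply: contraNneq ne => yy; rewrite -yy in hxy' *.
    by rewrite (iX u v y x x').
  rewrite -setI_eq0; apply/eqP/setP => z; rewrite !inE.
  apply/negP => /andP[/orP[]/eqP -> /orP[]/eqP E].
  - by rewrite E eqxx in xx.
  - by have := dis x y' xu yv'; rewrite E eqxx.
  - by have := dis x' y xu' yv; rewrite E eqxx.
  - by rewrite E eqxx in yy.
- by move=> x y; rewrite HE; apply: aX.
Qed.

Lemma not_dp_degree_colorableP (U : finType) (D : digraph U) : vset D != set0 ->
  ~ dp_degree_colorable D <->
  exists (W : finType) (X : U -> {set W}) (h : rel W), bad_config D X h.
Proof.
move=> V0; split=> [nD | [W [X [h bc]]] /(_ W X)].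
  apply: NNPP => no; apply: nD => W X H covH deg; apply: NNPP => ncol; apply: no.
  have cov := dp_cover_is_cover covH.
  exists W, X, (is_arc H); split=> //.
  - exact: cover_disjoint covH.
  - exact: cover_arcs covH.
  - move=> u v x y z /is_arc_in[uD vD _]; exact: (cov_out cov).
  - move=> u v x y z /is_arc_in[uD vD _]; exact: (cov_in cov).
  - by move=> col; apply: ncol; apply/colorableP.
have [H covH HE] := bad_config_cover bc.
move=> /(_ H covH (bc_deg bc)) /(colorableP covH V0)[c [cX sc]].
apply: (bc_uncol bc); exists c; split=> //.
by apply: sinks_eq sc => x y _ _; apply: HE.
Qed.

(** * The three explicit bad covers *)

Lemma dicycle_arc (U : finType) (s : seq U) (D : digraph U) :
  aset D = [set (x, next s x) | x in s] ->
  forall x y, is_arc D x y = (x \in s) && (y == next s x).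
Proof.
move=> AD x y; rewrite /is_arc AD; apply/imsetP/andP => [[z zs [-> ->]] // | [xs /eqP ->]].
by exists x.
Qed.

Lemma dicycle_bad (U : finType) (D : digraph U) n :
  2 <= n -> dicycle n D -> ~ dp_degree_colorable D.
Proof.
move=> n2 dD; have [s [us ss VD AD]] := dD; have arcE := dicycle_arc AD.
have V0 : vset D != set0.
  rewrite VD; case: s ss {us VD AD arcE} => [ss | x s _]; first by rewrite -ss in n2.
  by apply/set0Pn; exists x; rewrite inE mem_head.
(* With one colour per vertex the cover is a copy of D, whose only transversal is the directed cycle
   itself. *)
apply/not_dp_degree_colorableP => //; exists U, (fun v => [set v]), (is_arc D); split.
- by move=> u v _ _ uv; rewrite disjoints1 inE.
- by move=> x y xy; exists x, y; rewrite !inE.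
- by move=> u v x y z _ _ /set1P -> /set1P ->.
- by move=> u v x y z _ _ /set1P -> /set1P ->.
- move=> v vD; rewrite cards1 geq_max; apply/andP; split.
    rewrite -(cards1 (next s v)); apply: subset_leq_card; apply/subsetP => w.
    by rewrite !inE arcE => /andP[].
  rewrite -(cards1 (prev s v)); apply: subset_leq_card; apply/subsetP => w.
  by rewrite !inE arcE => /andP[_ /eqP ->]; rewrite prev_next.
move=> [c [cX sc]]; suff : acyclic D by apply; exists n, D.
apply/acyclic_sinks; apply: sinks_eq sc => x y xD yD.
by have /set1P -> := cX x xD; have /set1P -> := cX y yD.
Qed.

Lemma complete_bad (U : finType) (D : digraph U) : vset D != set0 ->
  bidirected_complete D -> ~ dp_degree_colorable D.
Proof.
move=> V0 [G GE [VD arcE']].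
have arcE u v : is_arc D u v = [&& u \in vset D, v \in vset D & u != v].
  by rewrite arcE' GE inE VD subUset !sub1set cards2 eqSS eqb1 andbA.
have [v0 v0D] := set0Pn _ V0.
apply/not_dp_degree_colorableP => //.
(* The vertices other than v0 serve as a palette with one colour fewer than there are vertices.
   Equal colours conflict, so two vertices sharing a colour, given by the pigeonhole principle, form
   a digon. *)
pose h (p q : U * U) := [&& is_arc D p.1 q.1, p.2 == q.2 & p.2 \in vset D :\ v0].
exists (U * U)%type, (fun v => setX [set v] (vset D :\ v0)), h; split.
- move=> u v _ _ uv; rewrite -setI_eq0; apply/eqP/setP => -[x a].
  by rewrite !inE /=; case: eqP => // ->; rewrite (negPf uv) andbF.
- move=> [x a] [y b] /and3P[/= xy /eqP <- aD]; exists x, y.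
  by rewrite !in_setX !inE !eqxx; move: aD; rewrite !inE => ->.
- move=> u v [x a] [y b] [z c] _; rewrite !in_setX => _ /andP[/set1P /= -> _] /andP[/set1P /= -> _].
  by move=> /and3P[_ /= /eqP <- _] /and3P[_ /= /eqP <- _].
- move=> u v [x a] [y b] [z c] _; rewrite !in_setX => _ /andP[/set1P /= -> _] /andP[/set1P /= -> _].
  by move=> /and3P[_ /= /eqP -> _] /and3P[_ /= /eqP -> _].
- move=> v vD; rewrite cardsX cards1 mul1n.
  have -> : #|vset D :\ v0| = #|vset D :\ v|.
    have := cardsD1 v (vset D); rewrite (cardsD1 v0 (vset D)) v0D vD.
    by move/eqP; rewrite eqn_add2l => /eqP.
  rewrite geq_max; apply/andP; split; apply: subset_leq_card; apply/subsetP => w.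
    by rewrite !inE arcE => /and3P[_ -> ]; rewrite eq_sym => ->.
  by rewrite !inE arcE => /and3P[-> _ ->].
move=> [c [cX sc]].
have cP v : v \in vset D -> (c v).1 = v /\ (c v).2 \in vset D :\ v0.
  by move=> vD; have := cX v vD; case: (c v) => a b; rewrite in_setX => /andP[/set1P -> ->].
have [/dinjectiveP inj | /dinjectivePn] := boolP (dinjectiveb (fun v => (c v).2) (mem (vset D))).
  have : #|vset D| <= #|vset D :\ v0|.
    rewrite -(card_in_imset inj).
    by apply: subset_leq_card; apply/subsetP => _ /imsetP[v vD ->]; have [] := cP v vD.
  by rewrite (cardsD1 v0) v0D ltnn.
move=> [u uD [v /andP[/= vu vD] cuv]].
have [||x xuv xs] := sc [set u; v].
- by rewrite subUset !sub1set uD.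
- by apply/set0Pn; exists u; rewrite set21.
have [cu1 cu2] := cP u uD; have [cv1 cv2] := cP v vD.
case/set2P: xuv => xE.
  by have := xs v (set22 u v); rewrite xE /h cu1 cv1 cuv eqxx cv2 arcE uD vD eq_sym vu.
by have := xs u (set21 u v); rewrite xE /h cu1 cv1 cuv eqxx cv2 arcE uD vD vu.
Qed.

Lemma constant_along_path (T : eqType) (f : T -> T) (g : T -> bool) x p :
  uniq (x :: p) -> path (frel f) x p ->
  {in x :: p, forall y, y != last x p -> g y = g (f y)} -> g x = g (last x p).
Proof.
elim: p x => // z p IHp x /= /andP[xp up] /andP[/eqP fx pz] gf.
rewrite gf ?mem_head //; last by apply: contraNneq xp => ->; exact: mem_last.
by rewrite fx; apply: IHp => // y yp; apply: gf; rewrite inE yp orbT.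
Qed.

Lemma bidirected_cycle_bad (U : finType) (D : digraph U) n :
  3 <= n -> bidirected_cycle n D -> ~ dp_degree_colorable D.
Proof.
move=> n3 [G [s [us ss VG GE]] [VD arcE']].
have s3 : 3 <= size s by rewrite ss.
have s2 : 2 <= size s by exact: ltnW.
have VDs : vset D = [set x in s] by rewrite VD.
have arcE u v : is_arc D u v = (u \in s) && ((v == next s u) || (v == prev s u)).
  rewrite arcE' GE; apply/imsetP/andP => [[x xs E] | [us' /orP[] /eqP ->]].
  - have xn := next_neq us s2 xs; have := esym E.
    move/(set2_eq xn) => [[<- <-] | [<- <-]]; first by rewrite xs eqxx.
    by rewrite mem_next xs prev_next // eqxx orbT.
  - by exists u.
  - by exists (prev s u); [rewrite mem_prev | rewrite (next_prev us) setUC].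
case sE : s => [|x0 p]; first by rewrite sE in s3.
have x0s : x0 \in s by rewrite sE mem_head.
have V0 : vset D != set0 by apply/set0Pn; exists x0; rewrite VDs in_set.
apply/not_dp_degree_colorableP => //.
pose l := last x0 p.
have ls : l \in s by rewrite sE; exact: mem_last.
have nl : next s l = x0 by rewrite next_nth ls sE index_last -?sE // nth_default.
(* With two colours, different colours conflict on every edge except the closing one from l to x0,
   where equal colours conflict. A colouring must thus be constant along the path and change at its
   closing edge, whatever the parity of the length. *)
pose m (p q : U * bool) := (q.1 == next s p.1) && ((p.2 == q.2) == (p.1 == l)).
pose h (p q : U * bool) := [&& p.1 \in s, q.1 \in s & m p q || m q p].
have hsym p1 q1 : h p1 q1 = h q1 p1 by rewrite /h orbC; case: (_ \in _); case: (_ \in _).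
have huniq x y a b b' : h (x, a) (y, b) -> h (x, a) (y, b') -> b = b'.
  move=> /and3P[/= xs ys h1] /and3P[_ _ h2].
  (* As the length is at least 3, an edge is traversed by [next] in only one direction, so only one
     of the two disjuncts of h applies. *)
  have nn : (y == next s x) && (x == next s y) = false.
    apply/negP => /andP[/eqP yE /eqP xE].
    by have := next_next_neq us s3 xs; rewrite -yE -xE eqxx.
  case: (boolP (y == next s x)) nn h1 h2; rewrite /m /= => yE /= xE; rewrite ?yE ?(negPf yE) ?xE /=.
    by rewrite !orbF; case: (x == l); case: a; case: b; case: b'.
  by case/andP=> _ + /andP[_]; case: (y == l); case: a; case: b; case: b'.
pose X v : {set U * bool} := setX [set v] [set: bool].
have inX v (q : U * bool) : (q \in X v) = (q.1 == v) by case: q => q b; rewrite in_setX !inE andbT.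
exists (U * bool)%type, X, h; split.
- move=> u v _ _ uv; rewrite -setI_eq0; apply/eqP/setP => q.
  by rewrite in_setI !inX inE; apply/negP => /andP[/eqP -> E]; rewrite E in uv.
- move=> [x a] [y b] /and3P[/= xs ys hm]; exists x, y; rewrite !inX eqxx; split=> //.
  rewrite arcE xs; case/orP: hm => /andP[/= /eqP -> _]; first by rewrite eqxx.
  by rewrite prev_next // eqxx orbT.
- move=> u v [x a] [y b] [z b'] _; rewrite !inX /= => _ /eqP -> /eqP -> h1 h2.
  by rewrite (huniq _ _ _ _ _ h1 h2).
- move=> u v [x a] [y b] [z b'] _; rewrite !inX /= => _ /eqP -> /eqP ->.
  by rewrite hsym => h1; rewrite hsym => h2; rewrite (huniq _ _ _ _ _ h1 h2).
- move=> v vD; have vs : v \in s by move: vD; rewrite VDs in_set.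
  have out2 : outdeg D v <= 2.
    rewrite -[2](_ : #|[set next s v; prev s v]| = 2); last first.
      by rewrite cards2 next_prev_neq.
    by apply: subset_leq_card; apply/subsetP => w; rewrite in_set arcE in_set2 => /andP[_].
  have -> : #|X v| = 2 by rewrite cardsX cards1 cardsT card_bool.
  rewrite geq_max out2; apply: leq_trans out2; apply: subset_leq_card; apply/subsetP => w.
  rewrite !in_set !arcE vs => /andP[ws /orP[] /eqP ->]; first by rewrite prev_next // eqxx orbT.
  by rewrite next_prev // eqxx.
move=> [c [cX sc]]; pose g v := (c v).2.
have cE v : v \in s -> c v = (v, g v).
  by move=> vs; have := cX v; rewrite VDs in_set inX /g => /(_ vs) /eqP; case: (c v) => a b /= ->.
have gm x : x \in s -> (g x == g (next s x)) = (x != l).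
  move=> xs; have [gx | ] := boolP ((g x == g (next s x)) == (x == l)); last first.
    by case: (g x == _); case: (x == l).
  have ns : next s x \in s by rewrite mem_next.
  have hx : h (c x) (c (next s x)).
    by rewrite !cE // /h /= xs ns /m /= eqxx gx.
  have [||y yS ys] := sc [set x; next s x].
  - by rewrite subUset !sub1set VDs !in_set xs ns.
  - by apply/set0Pn; exists x; rewrite set21.
  case/set2P: yS ys => -> ys; first by have := ys _ (set22 _ _); rewrite hx.
  by have := ys _ (set21 _ _); rewrite hsym hx.
have gx0 : g x0 = g l.
  apply: (constant_along_path (f := next s)); first by rewrite -sE.
    have := cycle_next us; rewrite {2}sE /= rcons_path => /andP[pp _].
    exact: pp.
  by move=> y; rewrite -sE => ys yl; apply/eqP; rewrite gm.
by have := gm l ls; rewrite nl gx0 !eqxx.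
Qed.

(** * Splitting at a separating vertex *)

Lemma conn1 (U : finType) (r : rel U) x : conn r [set x].
Proof.
apply/forallP => A; apply/implyP => /and3P[]; rewrite subset1.
by case/orP => // /eqP ->; rewrite eqxx.
Qed.

Lemma subdigraph_anti (U : finType) (C D : digraph U) :
  subdigraph C D -> subdigraph D C -> C = D.
Proof.
case: C => V1 A1 p1; case: D => V2 A2 p2 [/= V12 A12] [/= V21 A21].
have VE : V1 = V2 by apply/eqP; rewrite eqEsubset V12.
have AE : A1 = A2 by apply/eqP; rewrite eqEsubset A12.
by move: p1 p2; rewrite VE AE => p1 p2; rewrite (eq_irrelevance p1 p2).
Qed.

Lemma subdigraph_trans (U : finType) (C D E : digraph U) :
  subdigraph C D -> subdigraph D E -> subdigraph C E.
Proof. by move=> [V1 A1] [V2 A2]; split; [apply: subset_trans V2 | apply: subset_trans A2]. Qed.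

Lemma induced_subdigraph (U : finType) (D : digraph U) S : subdigraph (induced D S) D.
Proof. by split; apply: subsetIl. Qed.

Lemma subdigraph_induced (U : finType) (C D : digraph U) (S : {set U}) :
  subdigraph C D -> vset C \subset S -> subdigraph C (induced D S).
Proof.
move=> [VCD ACD] CS; split; rewrite subsetI ?VCD ?CS //= ACD /=.
apply/subsetP => -[x y] xy; have [xC yC _] := is_arc_in (xy : is_arc C x y).
by rewrite in_setX !(subsetP CS).
Qed.

Lemma subdigraph_arc (U : finType) (C D : digraph U) x y :
  subdigraph C D -> is_arc C x y -> is_arc D x y.
Proof. by move=> [_ /subsetP CD] /CD. Qed.

Lemma separation_opp (U : finType) (e : rel U) (K A B : {set U}) :
  separation (nbr e) K A B -> separation (nbr (opp e)) K A B.
Proof.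
move=> [A0 B0 AB ABK nAB]; split=> // x y xA yB.
by have := nAB x y xA yB; rewrite /nbr /opp orbC.
Qed.

(** Only the colours of v with no arc into the colouring of B are kept; each lost colour is charged
    to its own out-neighbour in B. Then no arc leads from v or A to B in the glued colouring, so a
    set meeting v or A finds its sink there. *)
Lemma restrict_cover (U W : finType) (V A B : {set U}) v (e : rel U)
    (X : U -> {set W}) (h : rel W) c :
  is_digraph V e -> is_cover V e X h -> v \in V ->
  separation (nbr e) (V :\ v) A B -> coloring X h B c ->
  exists X' : U -> {set W}, [/\ forall u, X' u \subset X u,
    forall u, u != v -> X' u = X u,
    #|X v| <= #|X' v| + #|outn e v :&: B| &
    forall c1, coloring X' h (v |: A) c1 -> exists c', coloring X h V c'].
Proof.
move=> eV cov vV sep [cX sc]; have [_ _ _ _ nAB] := sep.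
pose F := [set x in X v | [forall u in B, ~~ h x (c u)]].
pose X' u := if u == v then F else X u.
have X'v : X' v = F by rewrite /X' eqxx.
have X'X u : X' u \subset X u.
  rewrite /X'; case: eqP => [-> | _] //.
  by apply/subsetP => x; rewrite inE => /andP[].
have BV u : u \in B -> [/\ u != v, u \in V & u \notin A].
  move=> uB; have := separation_mem u sep; rewrite uB orbT !inE => /andP[-> ->].
  by split=> //; apply/negP => uA; apply: separation_disj sep uA uB.
have AV u : u \in v |: A -> u \in V /\ u \notin B.
  rewrite !inE => /orP[/eqP -> | uA].
    by split=> //; apply/negP => /BV[]; rewrite eqxx.
  have := separation_mem u sep; rewrite uA !inE => /andP[_ ->]; split=> //.
  by apply/negP => /BV[_ _]; rewrite uA.
exists X'; split=> //; first by move=> u uv; rewrite /X' (negPf uv).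
- rewrite X'v; pose g x := odflt v [pick u in B | h x (c u)].
  have gP x : x \in X v :\: F -> [/\ x \in X v, g x \in B & h x (c (g x))].
    case/setDP=> xv; rewrite inE xv /= negb_forall_in => /exists_inP[u uB hxu].
    rewrite /g; case: pickP => [w /andP[wB hw] // | /(_ u)].
    by rewrite /= uB (negbNE hxu).
  have ginj : {in X v :\: F &, injective g}.
    move=> x y /gP[xv gB hx] /gP[yv _ hy] gxy; rewrite -gxy in hy.
    by have [_ gV _] := BV _ gB; apply: (cov_in cov gV vV (cX _ gB) xv yv hx hy).
  have FX : F \subset X v by apply/subsetP => x; rewrite inE => /andP[].
  rewrite -(cardsID F (X v)) (setIidPr FX) leq_add2l -(card_in_imset ginj).
  apply: subset_leq_card; apply/subsetP => _ /imsetP[x /gP[xv gB hx] ->].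
  by have [_ gV _] := BV _ gB; rewrite !inE gB andbT (cov_arc cov vV gV xv (cX _ gB) hx).
move=> c1 [c1X sc1]; pose c' u := if u \in B then c u else c1 u.
have c'A u : u \in v |: A -> c' u = c1 u.
  by move=> /AV[_ uB]; rewrite /c' (negPf uB).
have c'B u : u \in B -> c' u = c u by rewrite /c' => ->.
have Vcase u : u \in V -> u \in v |: A \/ u \in B.
  move=> uV; have [-> | uv] := eqVneq u v; first by left; rewrite !inE eqxx.
  have : u \in V :\ v by rewrite !inE uv.
  by rewrite (separation_mem u sep) => /orP[uA | uB]; [left; rewrite !inE uA orbT | right].
exists c'; split=> [u uV | S SV S0].
  case: (Vcase u uV) => uC; last by rewrite c'B // cX.
  by rewrite c'A //; apply: (subsetP (X'X u)); apply: c1X.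
have [SA0 | SA0] := eqVneq (S :&: (v |: A)) set0.
  have SB : S \subset B.
    apply/subsetP => u uS; case: (Vcase u (subsetP SV u uS)) => // uA.
    by have := in_set0 u; rewrite -SA0 inE uS uA.
  have [x xS xs] := sc S SB S0; exists x => // y yS.
  by rewrite !c'B ?xs // (subsetP SB).
have [x] := sc1 (S :&: (v |: A)) (subsetIr _ _) SA0; rewrite inE => /andP[xS xA] xs.
exists x => // y yS; case: (Vcase y (subsetP SV y yS)) => yC.
  by rewrite !c'A // xs // inE yS.
rewrite c'A // c'B //; have [yv yV yA] := BV y yC; have [xV _] := AV x xA.
have [xv | xv] := eqVneq x v.
  have := c1X x xA; rewrite xv X'v inE => /andP[_ /forall_inP]; exact.
have xA' : x \in A by move: xA; rewrite !inE (negPf xv).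
apply/negP => hxy; have := nAB x y xA' yC; rewrite /nbr.
by rewrite (cov_arc cov xV yV (subsetP (X'X x) _ (c1X x xA)) (cX y yC) hxy).
Qed.

Lemma bad_config_is_cover (U : finType) (D : digraph U) (W : finType)
    (X : U -> {set W}) (h : rel W) :
  bad_config D X h -> is_cover (vset D) (is_arc D) X h.
Proof.
move=> bc; have [dX aX oX iX _ _] := bc.
have Xinj u v x : u \in vset D -> v \in vset D -> x \in X u -> x \in X v -> u = v.
  move=> uD vD xu xv; apply/eqP; apply: contraT => uv.
  by case: (disjoint_mem (dX u v uD vD uv) xu xv).
have arc u v x y : u \in vset D -> v \in vset D -> x \in X u -> y \in X v ->
    h x y -> is_arc D u v.
  move=> uD vD xu yv /aX[u' [v' [uv' xu' yv']]]; have [u'D v'D _] := is_arc_in uv'.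
  by rewrite (Xinj u u' x) // (Xinj v v' y).
split=> // u v uD vD x y; first exact: arc.
- move=> z xu yv zv hxy hxz; apply: (oX u v x) => //; exact: (arc u v x y).
- move=> z xu yv zv hyx hzx; apply: (iX v u x) => //; exact: (arc v u y x).
Qed.

(** * The two parts at a separating vertex *)

Section Split.
Variables (U : finType) (D : digraph U) (v : U) (A B : {set U}).
Hypotheses (vD : v \in vset D) (cD : conn (adj D) (vset D)).
Hypothesis sep : separation (adj D) (vset D :\ v) A B.

Lemma split_case u : u \in vset D -> [\/ u = v, u \in A | u \in B].
Proof.
move=> uD; have [uv | uv] := eqVneq u v; first exact: Or31.
have : u \in vset D :\ v by rewrite !inE uv.
by rewrite (separation_mem u sep) => /orP[]; [exact: Or32 | exact: Or33].
Qed.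

Lemma split_A u : u \in A -> [/\ u \in vset D, u != v & u \notin B].
Proof.
move=> uA; have := separation_mem u sep; rewrite uA !inE => /andP[-> ->].
by split=> //; apply/negP; apply: separation_disj sep uA.
Qed.

Lemma split_B u : u \in B -> [/\ u \in vset D, u != v & u \notin A].
Proof.
move=> uB; have := separation_mem u sep; rewrite uB orbT !inE => /andP[-> ->].
by split=> //; apply/negP => uA; apply: separation_disj sep uA uB.
Qed.

Lemma split_sub : v |: A \subset vset D.
Proof. by apply/subsetP => u; rewrite !inE => /orP[/eqP -> // | /split_A[]]. Qed.

Lemma split_vset : vset (induced D (v |: A)) = v |: A.
Proof. exact/setIidPr/split_sub. Qed.

(** A closed set containing v becomes closed in D after adding B; a closed set without v lies in A
    and is already closed in D, hence would be all of D. *)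
Lemma split_conn : conn (adj D) (v |: A).
Proof.
apply/forallP => C; apply/implyP => /and3P[CvA C0 /closed_inP Ccl].
have nAB x y : x \in A -> y \in B -> adj D x y = false.
  by move=> xA yB; have [_ _ _ _ n] := sep; apply/negbTE/n.
have sD := @nbr_sym U (is_arc D) : symmetric (adj D).
have [vC | vC] := boolP (v \in C).
  have E : C :|: B = vset D.
    apply: (conn_closed cD).
    - rewrite subUset (subset_trans CvA split_sub) /=.
      by apply/subsetP => u /split_B[].
    - by apply/set0Pn; exists v; rewrite inE vC.
    - move=> x y; rewrite !inE => xCB yD xy.
      case: (split_case yD) => [-> | yA | yB]; [by rewrite vC | | by rewrite yB orbT].
      case/orP: xCB => [xC | xB]; last by rewrite sD nAB in xy.
      by rewrite (Ccl x y) // !inE yA orbT.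
  rewrite eqEsubset CvA; apply/subsetP => u; rewrite !inE => /orP[/eqP -> // | uA].
  have [uD _ uB] := split_A uA.
  by move: uD; rewrite -E inE (negPf uB) orbF.
have CA u : u \in C -> u \in A.
  move=> uC; have := subsetP CvA u uC; rewrite !inE => /orP[/eqP uv | //].
  by rewrite -uv uC in vC.
have E : C = vset D.
  apply: (conn_closed cD) => //; first exact: subset_trans CvA split_sub.
  move=> x y xC yD xy; apply: (Ccl x y xC _ xy); rewrite !inE.
  case: (split_case yD) => [-> | -> | yB]; rewrite ?eqxx ?orbT //.
  by rewrite nAB // CA in xy.
by rewrite E vD in vC.
Qed.

Lemma split_connected : connected (induced D (v |: A)).
Proof.
apply/connectedP; rewrite split_vset conn_induced // split_conn; split=> //.
by apply/set0Pn; exists v; rewrite !inE eqxx.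
Qed.

Lemma split_card : #|vset (induced D (v |: A))| < #|vset D|.
Proof.
rewrite split_vset; apply: proper_card; apply/properP; split; first exact: split_sub.
have [_ /set0Pn[b bB] _ _ _] := sep; have [bD bv bA] := split_B bB.
by exists b => //; rewrite !inE negb_or bv.
Qed.

(** Deleting v leaves C connected, whether or not v is in C, so C cannot meet both A and B. *)
Lemma split_nonseparable C : subdigraph C D -> nonseparable C ->
  subdigraph C (induced D (v |: A)) \/ subdigraph C (induced D (v |: B)).
Proof.
move=> CD /nonseparableP[_ cC c2].
have [VCD _] := CD.
have cCv : conn (adj C) (vset C :\ v).
  have [vC | vC] := boolP (v \in vset C); first exact: c2.
  by rewrite (setDidPl _) // disjoint_sym disjoints1.
have [A0 | A0] := eqVneq (vset C :&: A) set0.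
  right; apply: subdigraph_induced CD _; apply/subsetP => u uC; rewrite !inE.
  case: (split_case (subsetP VCD u uC)) => [-> | uA | ->]; rewrite ?eqxx ?orbT //.
  by have := in_set0 u; rewrite -A0 inE uC uA.
have [B0 | B0] := eqVneq (vset C :&: B) set0.
  left; apply: subdigraph_induced CD _; apply/subsetP => u uC; rewrite !inE.
  case: (split_case (subsetP VCD u uC)) => [-> | -> | uB]; rewrite ?eqxx ?orbT //.
  by have := in_set0 u; rewrite -B0 inE uC uB.
case: (conn_separation cCv (A := vset C :&: A) (B := vset C :&: B)); split=> //.
- apply/setP => u; rewrite !inE; apply/negP => /andP[/andP[_ uA] /andP[_ uB]].
  exact: separation_disj sep uA uB.
- rewrite -setIUr; have [_ _ _ -> _] := sep.
  by apply/setP => u; rewrite !inE; case uC: (u \in vset C); rewrite ?andbF // (subsetP VCD) ?andbT.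
- move=> x y /setIP[_ xA] /setIP[_ yB]; have [_ _ _ _ nAB] := sep.
  apply: contraNN (nAB x y xA yB) => /orP[] /(subdigraph_arc CD) h; apply/orP; [by left | by right].
Qed.

Lemma split_block E : block (induced D (v |: A)) E -> block D E.
Proof.
move=> [ED1 nE maxE]; split=> //.
  exact: subdigraph_trans ED1 (induced_subdigraph _ _).
move=> C CD nC EC; case: (split_nonseparable CD nC) => CD1; first exact: maxE.
(* A competitor C in the other part forces E to be inside {v}. But v has a neighbour a in A, and the
   subdigraph induced on v and a is a larger nonseparable one, so E is not maximal in its part. *)
have Ev : vset E \subset [set v].
  apply/subsetP => u uE; rewrite inE.
  have [E1 _] := ED1; have [C2 _] := CD1; have [EC' _] := EC.
  have := subsetP E1 u uE; rewrite split_vset !inE => /orP[// | uA].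
  have := subsetP C2 u (subsetP EC' u uE); rewrite !inE => /andP[_ /orP[// | uB]].
  by case: (separation_disj sep uA uB).
have [/set0Pn[a0 a0A] _ _ _ _] := sep.
have [_ a0v _] := split_A a0A.
have [a aA va] : exists2 a, a \in A & adj D v a.
  have [| | |a] := conn_nbr split_conn (x := v) (y := a0).
  - by rewrite !inE eqxx.
  - by rewrite !inE a0A orbT.
  - by rewrite eq_sym.
  rewrite !inE => /orP[/eqP -> | aA va]; last by exists a.
  by case/orP => /is_arc_in[_ _]; rewrite eqxx.
have [aD av _] := split_A aA.
have vaA : [set v; a] \subset v |: A by rewrite subUset !sub1set !inE eqxx aA orbT.
pose F := induced D [set v; a].
have VF : vset F = [set v; a] by apply/setIidPr; rewrite subUset !sub1set vD.
have FD1 : subdigraph F (induced D (v |: A)).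
  by apply: subdigraph_induced; [exact: induced_subdigraph | rewrite VF].
have sD := @nbr_sym U (is_arc D) : symmetric (adj D).
have nF : nonseparable F.
  apply/nonseparableP; rewrite VF; split.
  - by apply/set0Pn; exists v; rewrite set21.
  - rewrite conn_induced //; apply/forallP => C'; apply/implyP.
    move=> /and3P[C'va /set0Pn[x xC'] /closed_inP cl]; rewrite eqEsubset C'va subUset !sub1set /=.
    have /set2P[xE | xE] := subsetP C'va x xC'; rewrite xE in xC'; rewrite xC' ?andbT //=.
      by apply: cl xC' _ va; rewrite set22.
    by apply: cl xC' _ _; [rewrite set21 | rewrite sD].
  - move=> x /set2P[] ->.
      rewrite (_ : [set v; a] :\ v = [set a]) ?conn1 //.
      by apply/setP => y; rewrite !inE; case: eqVneq => // ->; rewrite eq_sym (negPf av).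
    rewrite (_ : [set v; a] :\ a = [set v]) ?conn1 //.
    by apply/setP => y; rewrite !inE; case: (eqVneq y a) => [-> | _]; rewrite ?(negPf av) ?orbF.
have EF : subdigraph E F.
  split; first by rewrite VF; apply: subset_trans Ev _; rewrite sub1set set21.
  apply/subsetP => -[x y] xy; have [xE yE] := is_arc_in (xy : is_arc E x y).
  by have /set1P -> := subsetP Ev x xE; have /set1P -> := subsetP Ev y yE; rewrite eqxx.
have [FE _] := maxE F FD1 nF EF.
have := subsetP (subset_trans FE Ev) a; rewrite VF set22 inE (negPf av).
by move=> /(_ isT).
Qed.

End Split.

Lemma split_dp_degree_colorable (U : finType) (D : digraph U) v (A B : {set U}) :
  v \in vset D -> conn (adj D) (vset D) -> separation (adj D) (vset D :\ v) A B ->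
  dp_degree_colorable (induced D (v |: A)) -> dp_degree_colorable D.
Proof.
move=> vD cD sep col1; apply: NNPP => nD.
have V0 : vset D != set0 by apply/set0Pn; exists v.
have [W [X [h bc]]] := proj1 (not_dp_degree_colorableP V0) nD.
have cov := bad_config_is_cover bc; have [dX aX oX iX deg uncol] := bc.
have eD : is_digraph (vset D) (is_arc D) by exact: is_arc_in.
have sepB := separationC (@nbr_sym U (is_arc D)) sep.
have [c cc] : exists c, coloring X h B c.
  have [_ /set0Pn[b bB] _ _ _] := sep; have [bD bv _] := split_B sep bB.
  have /card_gt0P[w0 _] : 0 < #|X b|.
    apply: leq_trans (deg b bD); rewrite leq_max /outdeg /indeg.
    have [z zD /orP[bz | zb]] := conn_nbr cD bD vD bv.
      by apply/orP; left; apply/card_gt0P; exists z; rewrite inE.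
    by apply/orP; right; apply/card_gt0P; exists z; rewrite inE.
  have KD : v |: B \subset vset D.
    by apply/subsetP => u; rewrite !inE => /orP[/eqP -> // | /(split_B sep)[]].
  have [|||c cc _] := greedy (is_digraph_irr eD) cov _ (sub0set _) KD _ _ (split_conn vD cD sepB) (coloring0 X h (fun=> w0)) (z := v).
  - by move=> u /(subsetP KD) /deg.
  - by rewrite -setI_eq0 set0I.
  - by rewrite !inE eqxx.
  exists c; rewrite (_ : B = set0 :|: (v |: B) :\ v) //.
  by rewrite set0U setU1K //; apply/negP => /(split_B sep)[_]; rewrite eqxx.
(* The direction with fewer neighbours of v in B is used, so the number of removed colours is
   bounded by both counts. *)
have [X' [X'X X'E X'out X'in ext]] : exists X' : U -> {set W}, [/\ forall u, X' u \subset X u,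
    forall u, u != v -> X' u = X u,
    #|X v| <= #|X' v| + #|outn (is_arc D) v :&: B|,
    #|X v| <= #|X' v| + #|outn (opp (is_arc D)) v :&: B| &
    forall c1, coloring X' h (v |: A) c1 -> exists c', coloring X h (vset D) c'].
  have [le | /ltnW le] := leqP #|outn (is_arc D) v :&: B| #|outn (opp (is_arc D)) v :&: B|.
    have [X' [X'X X'E X'c ext]] := restrict_cover eD cov vD sep cc.
    by exists X'; split=> //; apply: leq_trans X'c _; rewrite leq_add2l.
  have [X' [X'X X'E X'c ext]] := restrict_cover (is_digraph_opp eD) (cover_opp cov) vD
    (separation_opp sep) (proj2 (coloring_opp X h B c) cc).
  exists X'; split=> //; first by apply: leq_trans X'c _; rewrite leq_add2l.
  move=> c1 /coloring_opp /ext[c' cc']; exists c'; exact/coloring_opp.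
pose D1 := induced D (v |: A); have VD1 : vset D1 = v |: A := split_vset vD sep.
have D1D u : u \in vset D1 -> u \in vset D by rewrite VD1; exact: (subsetP (split_sub vD sep)).
have arc1 u w : is_arc D1 u w -> is_arc D u w by rewrite is_arc_induced => /and3P[].
(* Arcs of h outside the part or at removed colours are dropped, as [bc_arc] requires. *)
pose h' x y := h x y && [exists u, exists w, [&& is_arc D1 u w, x \in X' u & y \in X' w]].
have h'h x y : h' x y -> h x y by case/andP.
suff : ~ dp_degree_colorable D1 by [].
apply/not_dp_degree_colorableP; first by apply/set0Pn; exists v; rewrite VD1 !inE eqxx.
have XX := fun u => subsetP (X'X u).
exists W, X', h'; split.
- move=> u w uD1 wD1 uw; rewrite -setI_eq0; apply/eqP/setP => x; rewrite !inE.
  apply/negP => /andP[/XX xu /XX xw].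
  exact: disjoint_mem (dX u w (D1D u uD1) (D1D w wD1) uw) xu xw.
- by move=> x y /andP[_ /existsP[u /existsP[w /and3P[uw xu yw]]]]; exists u, w.
- move=> u w x y z /arc1 uw /XX xu /XX yw /XX zw /h'h hxy /h'h hxz.
  exact: (oX u w x).
- move=> u w x y z /arc1 uw /XX xw /XX yu /XX zu /h'h hyx /h'h hzx.
  exact: (iX u w x).
- move=> u uD1; have uD := D1D u uD1.
  have := deg u uD; rewrite !geq_max => /andP[du1 du2].
  have sub (N N1 : {set U}) : N1 \subset N -> #|N1| <= #|N| by exact: subset_leq_card.
  have [uv | uv] := eqVneq u v; last first.
    rewrite X'E //; apply/andP; split.
      by apply: leq_trans du1; apply: sub; apply/subsetP => w; rewrite !inE => /arc1.
    by apply: leq_trans du2; apply: sub; apply/subsetP => w; rewrite !inE => /arc1.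
  (* With N the neighbourhood of v in one direction and N1 its share in the part, |N1| + |N :&: B|
     <= |N| <= |X v| <= |X' v| + |N :&: B|. *)
  have bound (N N1 : {set U}) : N1 \subset N -> N1 \subset v |: A ->
      #|N| <= #|X v| -> #|X v| <= #|X' v| + #|N :&: B| -> v \notin N -> #|N1| <= #|X' v|.
    move=> N1N N1A NX XN vN; rewrite -(leq_add2r #|N :&: B|); apply: leq_trans XN.
    apply: leq_trans NX; rewrite -cardsUI (_ : N1 :&: (N :&: B) = set0) ?cards0 ?addn0.
      by apply: subset_leq_card; rewrite subUset N1N subsetIl.
    apply/setP => w; rewrite !inE; apply/negP => /and3P[wN1 _ wB].
    have [_ wv wA] := split_B sep wB.
    by have := subsetP N1A w wN1; rewrite !inE (negPf wv) (negPf wA).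
  rewrite uv in du1 du2 *; apply/andP; split.
    apply: (bound (outn (is_arc D) v)) => //.
    + by apply/subsetP => w; rewrite !inE => /arc1.
    + by apply/subsetP => w; rewrite inE => /is_arc_in[_]; rewrite VD1.
    + by rewrite inE; apply/negP => /is_arc_in[_ _]; rewrite eqxx.
  apply: (bound (outn (opp (is_arc D)) v)) => //.
  + by apply/subsetP => w; rewrite !inE => /arc1.
  + by apply/subsetP => w; rewrite inE => /is_arc_in[]; rewrite VD1.
  + by rewrite inE; apply/negP => /is_arc_in[_ _]; rewrite eqxx.
move=> [c1 [c1X sc1]]; apply: uncol; apply: (ext c1); rewrite -VD1; split=> //.
apply: sinks_eq sc1 => u w uD1 wD1; rewrite /h'; case huw: (h _ _) => //=.
apply/existsP; exists u; apply/existsP; exists w; rewrite !c1X // !andbT is_arc_induced.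
rewrite -VD1 uD1 wD1 !andbT.
exact: (cov_arc cov (D1D u uD1) (D1D w wD1) (XX _ _ (c1X u uD1)) (XX _ _ (c1X w wD1)) huw).
Qed.

(** * Gluing bad covers by disjoint union *)

Definition sum_rel (S T : finType) (r : rel S) (r' : rel T) : rel (S + T) :=
  fun p q => match p, q with
             | inl x, inl y => r x y
             | inr x, inr y => r' x y
             | _, _ => false
             end.

Lemma mem_inl (S T : finType) (E : {set S}) (F : {set T}) x :
  (inl x \in @inl S T @: E :|: @inr S T @: F) = (x \in E).
Proof.
rewrite inE mem_imset; last by move=> y z [].
by rewrite orbC; case: imsetP => // -[].
Qed.

Lemma mem_inr (S T : finType) (E : {set S}) (F : {set T}) x :
  (inr x \in @inl S T @: E :|: @inr S T @: F) = (x \in F).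
Proof.
rewrite inE [_ \in inr @: _]mem_imset; last by move=> y z [].
by case: imsetP => // -[].
Qed.

Lemma card_sum_set (S T : finType) (E : {set S}) (F : {set T}) :
  #|@inl S T @: E :|: @inr S T @: F| = #|E| + #|F|.
Proof.
rewrite cardsU !card_imset; [|by move=> x y []|by move=> x y []].
rewrite (_ : _ :&: _ = set0) ?cards0 ?subn0 //.
by apply/setP => -[x | x]; rewrite !inE; apply/negP => /andP[/imsetP[y _] + /imsetP[z _]].
Qed.

Lemma split_not_dp_degree_colorable (U : finType) (D : digraph U) v (A B : {set U}) :
  v \in vset D -> conn (adj D) (vset D) -> separation (adj D) (vset D :\ v) A B ->
  ~ dp_degree_colorable (induced D (v |: A)) ->
  ~ dp_degree_colorable (induced D (v |: B)) -> ~ dp_degree_colorable D.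
Proof.
move=> vD cD sep.
have sepB := separationC (@nbr_sym U (is_arc D)) sep.
set D1 := induced D (v |: A); set D2 := induced D (v |: B).
have VD1 : vset D1 = v |: A := split_vset vD sep.
have VD2 : vset D2 = v |: B := split_vset vD sepB.
have v1 : v \in vset D1 by rewrite VD1 !inE eqxx.
have v2 : v \in vset D2 by rewrite VD2 !inE eqxx.
have V0 (E : digraph U) : v \in vset E -> vset E != set0.
  by move=> vE; apply/set0Pn; exists v.
case/(not_dp_degree_colorableP (V0 _ v1)) => W1 [X1 [h1 bc1]].
case/(not_dp_degree_colorableP (V0 _ v2)) => W2 [X2 [h2 bc2]].
apply/(not_dp_degree_colorableP (V0 _ vD)).
(* X1 is arbitrary outside its part; cutting it down there leaves v as the only vertex with colours
   from both covers. *)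
pose S1 u := if u \in vset D1 then X1 u else set0.
pose S2 u := if u \in vset D2 then X2 u else set0.
have S1P u x : (x \in S1 u) = (u \in vset D1) && (x \in X1 u).
  by rewrite /S1; case: ifP; rewrite ?inE.
have S2P u x : (x \in S2 u) = (u \in vset D2) && (x \in X2 u).
  by rewrite /S2; case: ifP; rewrite ?inE.
pose X u := @inl W1 W2 @: S1 u :|: @inr W1 W2 @: S2 u.
have arc1 u w : u \in vset D1 -> w \in vset D1 -> is_arc D1 u w = is_arc D u w.
  by rewrite is_arc_induced VD1 => -> ->; rewrite !andbT.
have arc2 u w : u \in vset D2 -> w \in vset D2 -> is_arc D2 u w = is_arc D u w.
  by rewrite is_arc_induced VD2 => -> ->; rewrite !andbT.
have sub1 u w : is_arc D1 u w -> is_arc D u w by rewrite is_arc_induced => /and3P[].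
have sub2 u w : is_arc D2 u w -> is_arc D u w by rewrite is_arc_induced => /and3P[].
have arcU u w : is_arc D u w -> is_arc D1 u w || is_arc D2 u w.
  move=> uw; rewrite !is_arc_induced uw /= !inE; have [uD wD _] := is_arc_in uw.
  have [_ _ _ _ nAB] := sep.
  case: (split_case sep uD) => uC; case: (split_case sep wD) => wC; rewrite ?uC ?wC ?eqxx ?orbT //.
    by have := nAB u w uC wC; rewrite /adj uw.
  by have := nAB w u wC uC; rewrite /adj uw orbT.
exists (W1 + W2)%type, X, (sum_rel h1 h2); split.
- move=> u w uD wD uw; rewrite -setI_eq0; apply/eqP/setP => -[x | x]; rewrite in_set0 in_setI.
    rewrite !mem_inl !S1P; apply/negP => /andP[/andP[uD1 xu] /andP[wD1 xw]].
    exact: disjoint_mem (bc_disj bc1 uD1 wD1 uw) xu xw.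
  rewrite !mem_inr !S2P; apply/negP => /andP[/andP[uD1 xu] /andP[wD1 xw]].
  exact: disjoint_mem (bc_disj bc2 uD1 wD1 uw) xu xw.
- move=> [x | x] [y | y] //= => [/(bc_arc bc1) | /(bc_arc bc2)] [u [w [uw xu yw]]].
    exists u, w; have [uD1 wD1 _] := is_arc_in uw.
    by rewrite !mem_inl !S1P uD1 wD1 xu yw sub1.
  exists u, w; have [uD1 wD1 _] := is_arc_in uw.
  by rewrite !mem_inr !S2P uD1 wD1 xu yw sub2.
- move=> u w [x | x] [y | y] [z | z] uw //; rewrite ?mem_inl ?mem_inr ?S1P ?S2P /=.
    move=> /andP[uD1 xu] /andP[wD1 yw] /andP[_ zw] hxy hxz; congr inl.
    by apply: (bc_out bc1 (u := u) (v := w) (x := x)) => //; rewrite arc1.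
  move=> /andP[uD1 xu] /andP[wD1 yw] /andP[_ zw] hxy hxz; congr inr.
  by apply: (bc_out bc2 (u := u) (v := w) (x := x)) => //; rewrite arc2.
- move=> u w [x | x] [y | y] [z | z] uw //; rewrite ?mem_inl ?mem_inr ?S1P ?S2P /=.
    move=> /andP[uD1 xu] /andP[wD1 yw] /andP[_ zw] hxy hxz; congr inl.
    by apply: (bc_in bc1 (u := u) (v := w) (x := x)) => //; rewrite arc1.
  move=> /andP[uD1 xu] /andP[wD1 yw] /andP[_ zw] hxy hxz; congr inr.
  by apply: (bc_in bc2 (u := u) (v := w) (x := x)) => //; rewrite arc2.
- have degS (E : digraph U) (W : finType) (Y : U -> {set W}) u :
      {in vset E, forall u, maxn (outdeg E u) (indeg E u) <= #|Y u|} ->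
      maxn (outdeg E u) (indeg E u) <= #|if u \in vset E then Y u else set0|.
    move=> degE; case: ifP => [/degE // | /negP uE]; rewrite cards0 leqn0.
    rewrite -leqn0 geq_max !leqn0 !cards_eq0.
    by apply/andP; split; apply/eqP/setP => w; rewrite !inE; apply/negP => /is_arc_in[].
  move=> u uD; rewrite card_sum_set.
  have := degS _ _ _ u (bc_deg bc1); have := degS _ _ _ u (bc_deg bc2).
  rewrite !geq_max => /andP[o2 i2] /andP[o1 i1].
  apply/andP; split.
    apply: leq_trans (leq_add o1 o2); apply: leq_trans (leq_card_setU _ _).
    by apply: subset_leq_card; apply/subsetP => w; rewrite !in_set => /arcU.
  apply: leq_trans (leq_add i1 i2); apply: leq_trans (leq_card_setU _ _).
  by apply: subset_leq_card; apply/subsetP => w; rewrite !in_set => /arcU.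
move=> [c [cX sc]].
have D1D u : u \in vset D1 -> u \in vset D by rewrite /= => /setIP[].
have D2D u : u \in vset D2 -> u \in vset D by rewrite /= => /setIP[].
have D12 u : u \in vset D1 -> u \in vset D2 -> u = v.
  rewrite VD1 VD2 !inE => /orP[/eqP // | uA] /orP[/eqP // | uB].
  by case: (separation_disj sep uA uB).
(* The colour of v belongs to one of the two covers. All other vertices of that part have only
   colours of that cover, so c would colour the part. *)
case cv: (c v) => [w1 | w2].
  apply: (bc_uncol bc1); pose c1 u := if c u is inl x then x else w1.
  have cE u : u \in vset D1 -> c u = inl (c1 u).
    move=> u1; have := cX u (D1D u u1); rewrite /c1; case cu: (c u) => [x // | x].
    by rewrite mem_inr S2P => /andP[u2 _]; rewrite (D12 u u1 u2) cv in cu.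
  exists c1; split=> [u u1 | ].
    by have := cX u (D1D u u1); rewrite cE // mem_inl S1P => /andP[].
  apply: sinks_eq (sinks_sub _ sc); last by apply/subsetP => u /D1D.
  by move=> u w u1 w1'; rewrite !cE.
apply: (bc_uncol bc2); pose c2 u := if c u is inr x then x else w2.
have cE u : u \in vset D2 -> c u = inr (c2 u).
  move=> u2; have := cX u (D2D u u2); rewrite /c2; case cu: (c u) => [x | x //].
  by rewrite mem_inl S1P => /andP[u1 _]; rewrite (D12 u u1 u2) cv in cu.
exists c2; split=> [u u2 | ].
  by have := cX u (D2D u u2); rewrite cE // mem_inr S2P => /andP[].
apply: sinks_eq (sinks_sub _ sc); last by apply/subsetP => u /D2D.
by move=> u w u2 w2'; rewrite !cE.
Qed.

Lemma types_bad (U : finType) (D : digraph U) : vset D != set0 ->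
  [\/ exists2 n : nat, 2 <= n & dicycle n D,
      exists2 n : nat, 3 <= n & bidirected_cycle n D
    | bidirected_complete D] -> ~ dp_degree_colorable D.
Proof.
move=> V0 [[n n2] | [n n3] |]; first exact: dicycle_bad.
  exact: bidirected_cycle_bad.
exact: complete_bad.
Qed.

Theorem theorem9 (U : finType) (D : digraph U) (hD : connected D) :
  ~ dp_degree_colorable D <->
  (forall B : digraph U, block D B ->
     [\/ exists2 n : nat, 2 <= n & dicycle n B,
         exists2 n : nat, 3 <= n & bidirected_cycle n B
       | bidirected_complete B]).
Proof.
(* Induction on the number of vertices: a nonseparable D is its own only block, and otherwise both
   parts at a separating vertex are connected and smaller. *)
have [n] := ubnP #|vset D|; elim: n => // n IHn in D hD * => ltDn.
have [V0 cD] := proj1 (connectedP D) hD.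
have [nsD | sepD] := classic (exists v, separating D v); last first.
  have nsD : nonseparable D by [].
  split=> [nD B [BD nsB maxB] | types].
    have DB : subdigraph D B by apply: maxB => //; split; apply: subxx.
    by rewrite (subdigraph_anti BD DB); apply: nonseparable_types.
  apply: types_bad V0 (types D _); split=> //.
have [v sv] := nsD; have [vD _] := sv.
have [A [B sep]] := connPn (proj1 (separatingP vD) sv).
have sepB := separationC (@nbr_sym U (is_arc D)) sep.
have IH1 := IHn _ (split_connected vD cD sep) (leq_trans (split_card vD sep) (ltDn : _ <= n)).
have IH2 := IHn _ (split_connected vD cD sepB) (leq_trans (split_card vD sepB) (ltDn : _ <= n)).
split=> [nD E blE | types].
  (* A block of D lies in one part and is maximal there as well; that part is not colourable, or D
     would be. *)
  have [ED nE maxE] := blE.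
  have blk (F : digraph U) : subdigraph F D -> subdigraph E F -> block F E.
    by move=> FD EF; split=> // C CF; apply: maxE; apply: subdigraph_trans CF FD.
  case: (split_nonseparable sep ED nE) => EF.
    apply: (proj1 IH1) => [col1 |]; last by apply: blk EF; apply: induced_subdigraph.
    by apply: nD; apply: (split_dp_degree_colorable vD cD sep).
  apply: (proj1 IH2) => [col1 |]; last by apply: blk EF; apply: induced_subdigraph.
  by apply: nD; apply: (split_dp_degree_colorable vD cD sepB).
apply: (split_not_dp_degree_colorable vD cD sep).
  by apply: (proj2 IH1) => E /(split_block vD cD sep); apply: types.
by apply: (proj2 IH2) => E /(split_block vD cD sepB); apply: types.
Qed.
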